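(* Let $K$ be a finite simplicial complex and $G$ an abelian group. Then for every simplex $\sigma$ of $K$, $LH_{*,*}(K;G)\cong LH_{*,*}(S_\sigma(K);G)$ and $L\tilde H_{*,*}(K;G)\cong L\tilde H_{*,*}(S_\sigma(K);G)$ as bigraded groups. Consequently, for a polyhedron $X$, setting $LH_{*,*}(X;G)=LH_{*,*}(K;G)$ and $L\tilde H_{*,*}(X;G)=L\tilde H_{*,*}(K;G)$ for a triangulation $K$ of $X$, these groups are independent (up to isomorphism) of the choice of triangulation and are homeomorphism invariants of $X$.
   Context: A finite (abstract) simplicial complex $K$ with finite vertex set $S$ is a set of subsets of $S$ containing $\emptyset$ and every singleton, closed under taking subsets; $|\sigma|=\#\sigma-1$ (so $|\emptyset|=-1$); $\mathrm{link}_K\sigma=\{\tau\in K:\sigma\cup\tau\in K,\ \sigma\cap\tau=\emptyset\}$. For a finite set $\sigma$, $\partial\sigma$ denotes the simplicial complex of all proper subsets of $\sigma$. Stellar subdivision: for $\sigma\in K$, $S_\sigma(K)$ is defined as follows. If $\sigma=\emptyset$, $S_\emptyset(K)=K$. If $|\sigma|=0$, $S_\sigma(K)$ is obtained from $K$ by renaming the unique vertex of $\sigma$ by a new vertex $v$. If $|\sigma|>0$, $S_\sigma(K)$ has vertex set $S\cup\{v\}$ with $v$ a new vertex and $S_\sigma(K)=\{\tau\in K:\sigma\not\subseteq\tau\}\cup\{\{v\}\cup\sigma'\cup\tau:\sigma'\in\partial\sigma,\ \tau\in\mathrm{link}_K\sigma\}$. Geometric realization: if $S=\{v_1,\dots,v_m\}$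 and $e_i$ are the standard basis vectors of $\mathbb R^m$, $|K|$ is the union of the convex hulls of $e_{i_0},\dots,e_{i_s}$ over all simplices $\{v_{i_0},\dots,v_{i_s}\}\in K$. A polyhedron is a space homeomorphic to some $|K|$; such $K$ is a triangulation. Chain groups: for $k\geqslant -1$, $C_k(K)$ is generated by ordered sequences $[v_0,\dots,v_k]$ of vertices modulo: $0$ if an entry repeats or $\{v_0,\dots,v_k\}\notin K$; swapping two entries changes the sign; $C_{-1}(K)$ is generated by $[\,]$. These are chain simplices, identified with their vertex sets for inclusion. Differentials: $d[v_0,\dots,v_k]=\sum_i(-1)^i[v_0,\dots,\hat v_i,\dots,v_k]$ ($d[v_0]=[\,]$), $\delta[v_0,\dots,v_k]=\sum_{v\in S}[v,v_0,\dots,v_k]$ ($\delta[\,]=\sum_v[v]$). For $s,t\geqslant -1$, $\tilde T_{s,t}(K)\subseteq C_s(K)\otimes C_t(K)$ is generated by $\sigma\otimes\tau$ with chain simplices $\sigma\subseteq\tau$, $|\sigma|=s,|\tau|=t$, a double complex with $\partial(\sigma\otimes\tau)=(d\sigma)\otimes\tau+(-1)^{|\sigma|}\sigma\otimes(\delta\tau)$; $T_{s,t}(K)$ is the analogous double subcomplex with $s,t\geqslant 0$. Tensor with $G$. The reduced $L$-spectral sequence $\tilde L^r_{s,t}(K;G)$ (resp. $L$-spectral sequence $L^r_{s,t}(K;G)$) is the spectral sequence of the filtration $F_m=\bigoplus_{s\leqslant m}\tilde T_{s,*}(K;G)$ (resp. of $T$), with $\partial_r$ of bidegree $(-r,-r+1)$: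 the $E^1$-term is the homology of the columns $(\tilde T_{s,*},\delta)$ and $\partial_1$ is induced by $d$. The reduced $L$-homology is $L\tilde H_{s,t}(K;G)=\tilde L^2_{s,t}(K;G)$ and the $L$-homology is $LH_{s,t}(K;G)=L^2_{s,t}(K;G)$. *)

(* Defs.v *)
From HB Require Import structures.
From mathcomp Require Import all_boot all_order all_algebra ring_quotient.
From mathcomp Require Import boolp.

Set Implicit Arguments.
Unset Strict Implicit.
Unset Printing Implicit Defensive.

Import Order.TTheory GRing.Theory Num.Theory.
Local Open Scope ring_scope.

(* A complex is a set K of subsets of a finite type V, containing the   *)
(* empty set and closed under taking subsets.  Its vertex set is the    *)
(* set of v with [set v] \in K (so V may contain non-vertices; every    *)
(* complex of the paper is represented by taking V = its vertex set).   *)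

Definition is_complex (V : finType) (K : {set {set V}}) : Prop :=
  set0 \in K /\ (forall s t : {set V}, s \in K -> t \subset s -> t \in K).

Definition vertices (V : finType) (K : {set {set V}}) : {set V} :=
  [set v | [set v] \in K].

Definition link (V : finType) (K : {set {set V}}) (sg : {set V}) : {set {set V}} :=
  [set t in K | (sg :|: t \in K) && [disjoint sg & t]].

(* Stellar subdivision S_sigma(K); the new vertex v is None, the old
   vertices x are Some x. *)
Definition stellar (V : finType) (K : {set {set V}}) (sg : {set V})
    : {set {set option V}} :=
  if #|sg| == 0%N then [set [set Some x | x in t] | t : {set V} in K]
  else if #|sg| == 1%N then
    [set [set (if x \in sg then None else Some x) | x in t] | t : {set V} in K]
  else
    [set [set Some x | x in t] | t : {set V} in K & ~~ (sg \subset t)] :|: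
    [set None |: [set Some x | x in s' :|: t]
       | s' : {set V} in powerset sg, t : {set V} in link K sg & s' != sg].

(* The double complex T~_{s,t}(K;G) (red = true) and T_{s,t}(K;G)       *)
(* (red = false), with coefficients in an abelian group G.              *)
(* The chain simplex of a simplex is oriented by the increasing order   *)
(* of enum_rank; then T_{s,t}(K) is free on the pairs (sigma, tau),     *)
(* sigma \subset tau \in K, |sigma| = s, |tau| = t, and T_{s,t}(K;G) is  *)
(* the group of G-valued functions supported on such pairs.  All        *)
(* bidegrees live in one ambient group Mod; inT s t selects T_{s,t}.    *)

Section DoubleComplex.
Variables (V : finType) (G : zmodType) (K : {set {set V}}) (red : bool).

Definition cellT := ({set V} * {set V})%type.
Definition Mod := {ffun cellT -> G}.

Definition valid (x : cellT) : bool :=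
  [&& x.1 \subset x.2, x.2 \in K & red || (x.1 != set0)].

(* bidegree (|sigma|, |tau|), with |sigma| = #sigma - 1 *)
Definition bideg (x : cellT) : int * int := (#|x.1|%:Z - 1, #|x.2|%:Z - 1).

Definition inT (s t : int) (c : Mod) : bool :=
  [forall x, (c x != 0) ==> valid x && (bideg x == (s, t))].

Definition vless (u v : V) : bool := (enum_rank u < enum_rank v)%N.

Definition sgnG (n : nat) (g : G) : G := if odd n then - g else g.

(* d (x) id :  d[v0..vk] = sum_i (-1)^i [v0..^vi..vk], acting on sigma *)
Definition dd (c : Mod) : Mod :=
  [ffun x : cellT => if valid x then
      \sum_(v in ~: x.1) sgnG #|[set u in x.1 | vless u v]| (c (v |: x.1, x.2))
    else 0].

(* id (x) delta :  delta[w0..wk] = sum_v [v,w0..wk], acting on tau *)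
Definition delta (c : Mod) : Mod :=
  [ffun x : cellT => if valid x then
      \sum_(v in x.2) sgnG #|[set u in x.2 | vless u v]| (c (x.1, x.2 :\ v))
    else 0].

Variables (s t : int).

(* cycles of E^1 (under delta) whose class is killed by partial_1 (d) *)
Definition Zpred : {pred Mod} :=
  [pred c : Mod | [&& inT s t c, delta c == 0 &
     `[< exists y, inT (s - 1) (t - 1) y /\ dd c = delta y >] ]].

Lemma inT0 a b : inT a b 0.
Proof. by apply/forallP => x; rewrite ffunE eqxx. Qed.

Lemma inTB a b c1 c2 : inT a b c1 -> inT a b c2 -> inT a b (c1 - c2).
Proof.
move=> /forallP h1 /forallP h2; apply/forallP => x; rewrite !ffunE.
apply/implyP => hx; case: (c1 x =P 0) => e1.
  case: (c2 x =P 0) => e2; last by apply: (implyP (h2 x)); apply/eqP.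
  by move: hx; rewrite e1 e2 subrr eqxx.
by apply: (implyP (h1 x)); apply/eqP.
Qed.

Lemma sgnGB n (a b : G) : sgnG n (a - b) = sgnG n a - sgnG n b.
Proof. by rewrite /sgnG; case: odd; rewrite ?opprB ?opprD ?opprK // addrC. Qed.

Lemma ddB c1 c2 : dd (c1 - c2) = dd c1 - dd c2.
Proof.
apply/ffunP => x; rewrite !ffunE; case: ifP => _; last by rewrite subrr.
by rewrite -sumrB; apply: eq_bigr => v _; rewrite !ffunE sgnGB.
Qed.

Lemma deltaB c1 c2 : delta (c1 - c2) = delta c1 - delta c2.
Proof.
apply/ffunP => x; rewrite !ffunE; case: ifP => _; last by rewrite subrr.
by rewrite -sumrB; apply: eq_bigr => v _; rewrite !ffunE sgnGB.
Qed.

Lemma delta0 : delta 0 = 0.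
Proof. by have := deltaB 0 0; rewrite !subrr. Qed.

Lemma dd0 : dd 0 = 0.
Proof. by have := ddB 0 0; rewrite !subrr. Qed.

Lemma Zpred_closed : GRing.zmod_closed Zpred.
Proof.
split.
  rewrite inE /= inT0 delta0 eqxx /=; apply/asboolP.
  by exists 0; rewrite inT0 dd0 delta0.
move=> c1 c2; rewrite !inE /= => /and3P[h1 /eqP e1 /asboolP[y1 [hy1 f1]]].
move=> /and3P[h2 /eqP e2 /asboolP[y2 [hy2 f2]]].
rewrite inTB // deltaB e1 e2 subrr eqxx /=; apply/asboolP.
by exists (y1 - y2); rewrite inTB // ddB deltaB f1 f2.
Qed.

HB.instance Definition _ := GRing.isZmodClosed.Build Mod Zpred Zpred_closed.

Definition Zt : Type := {c : Mod | c \in Zpred}.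
HB.instance Definition _ := [isSub of Zt for @proj1_sig Mod (fun c => c \in Zpred)].
HB.instance Definition _ := [Choice of Zt by <:].
HB.instance Definition _ := [SubChoice_isSubZmodule of Zt by <:].

Definition Bpred : {pred Zt} :=
  [pred z : Zt | `[< exists y w, [/\ inT s (t - 1) y, inT (s + 1) t w,
                                     delta w = 0 & val z = delta y + dd w] >] ].

Lemma Bpred_closed : GRing.zmod_closed Bpred.
Proof.
split.
  rewrite inE /=; apply/asboolP; exists 0, 0.
  by rewrite !inT0 delta0 dd0 addr0.
move=> z1 z2; rewrite !inE /= => /asboolP[y1 [w1 [hy1 hw1 e1 f1]]].
move=> /asboolP[y2 [w2 [hy2 hw2 e2 f2]]]; apply/asboolP.
exists (y1 - y2), (w1 - w2); split; rewrite ?inTB // ?deltaB ?e1 ?e2 ?subrr //.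
by rewrite f1 f2 ddB opprD addrACA.
Qed.

HB.instance Definition _ := GRing.isZmodClosed.Build Zt Bpred Bpred_closed.

(* E^2_{s,t} of the spectral sequence of the column filtration:
   ker(partial_1) / im(partial_1) on E^1 = H(T_{s,*}, delta). *)
Definition LH : zmodType := Quotient.quot Bpred.

End DoubleComplex.

Definition zmod_iso (A B : zmodType) : Prop :=
  exists f : A -> B, (forall x y, f (x + y) = f x + f y) /\ bijective f.

From mathcomp Require Import classical_sets reals topology normedtype matrix_topology matrix_normedtype.
Import numFieldTopology.Exports numFieldNormedType.Exports.
Local Open Scope classical_set_scope.

Definition basis_vec (R : realType) (V : finType) (v : V) : 'rV[R]_#|V| :=
  delta_mx 0 (enum_rank v).
Arguments basis_vec R {V} v.

Definition realization (R : realType) (V : finType) (K : {set {set V}})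
    : set 'rV[R]_#|V| :=
  [set x | exists2 sg, sg \in K &
     exists lam : V -> R, [/\ forall v, 0 <= lam v,
        \sum_(v in sg) lam v = 1 & x = \sum_(v in sg) lam v *: basis_vec R v] ].
Arguments realization R {V} K.

Definition homeomorphic_to (X Y : topologicalType) (A : set Y) : Prop :=
  exists (f : X -> Y) (g : Y -> X),
    [/\ continuous f, {within A, continuous g}, f @` setT = A
      & forall x, g (f x) = x].

Definition homeomorphic (X Y : topologicalType) : Prop :=
  exists (f : X -> Y) (g : Y -> X),
    [/\ continuous f, continuous g, cancel f g & cancel g f].

Definition triangulation (R : realType) (X : topologicalType)
    (V : finType) (K : {set {set V}}) : Prop :=
  is_complex K /\ @homeomorphic_to X 'rV[R]_#|V| (realization R K).

(* Main.v *)
(* The column E^1_{s,*} of the spectral sequence over a simplex s is the cohomology of K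
   relative to the complement of the open star of s, so LH_{s,t} is Cech homology, for the
   cover by open stars, with coefficients in the precosheaf of local cohomology.  Taking two
   covers instead of one gives a double complex of pairs (s, t), s in K1, t in K2, the open
   star of t lying in that of s: it is covariant in K1 and contravariant in K2, through
   integer matrices acting on the two sides, and these actions commute strictly.

   If K1 subdivides K0 (open stars of K1 are contained in open stars of K0), then
   E(K0,K0) -> E(K0,K1) <- E(K1,K1) are isomorphisms.  The first map is a chain
   equivalence compatible with carriers.  The second one factors through the pairs with
   car s <= car t; enlarging the relation s <= t to this one does not change the homology of
   any column because the added cells cancel in pairs {t, b |: t}.  A stellar subdivision is
   of this kind, all the carriers involved being cones.

   Homeomorphic polyhedra need not be PL homeomorphic, so the second part does not follow
   from the first.  Instead, subdivide two triangulations K and L of one space alternately,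
   m0 > n0 > m1 > n1 > m2 > n2, each open star of a term lying in an open star of the
   preceding one.  By strict functoriality the map E(m1,m1) -> E(n0,n1) becomes an
   isomorphism after composition on either side, hence is one, and E(n0,n1) is LH(L).
   Bisecting edges suffices to make open stars small: by the median formula, cutting an edge
   of squared length > 13/16 M in its midpoint creates only edges of squared length
   <= 13/16 M when all edges had squared length <= M. *)
Require Import Defs.
From HB Require Import structures.
From mathcomp Require Import all_boot all_order all_algebra generic_quotient ring_quotient.
From mathcomp Require Import boolp functions.
From mathcomp Require Import zify ring lra.

Set Implicit Arguments.
Unset Strict Implicit.
Unset Printing Implicit Defensive.

(** * Subquotients and integer matrices *)

Section SubQuotients.
Import GRing.Theory.
Local Open Scope ring_scope.

(** A subquotient is kept as two predicates on an ambient group, cycles [zq] and boundaries [bq];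
    the quotient itself is formed only at the very end, in [LH]. *)
Record subquot (M : zmodType) := SubQuot {
  zq : M -> Prop;
  bq : M -> Prop;
  zqB : forall x y, zq x -> zq y -> zq (x - y);
  bqB : forall x y, bq x -> bq y -> bq (x - y) }.

(** On representatives, this expresses that [f] induces an isomorphism of the subquotients. *)
Record qiso (M N : zmodType) (S : subquot M) (T : subquot N) (f : M -> N) : Prop :=
  QIso {
  qisoB : forall x y, f (x - y) = f x - f y;
  qisoz : forall x, zq S x -> zq T (f x);
  qisob : forall x, bq S x -> bq T (f x);
  qiso_inj : forall x, zq S x -> bq T (f x) -> bq S x;
  qiso_surj : forall y, zq T y -> exists2 x, zq S x & bq T (y - f x) }.

Record qmor (M N : zmodType) (S : subquot M) (T : subquot N) (f : M -> N) : Prop :=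
  QMor {
  qmorB : forall x y, f (x - y) = f x - f y;
  qmorz : forall x, zq S x -> zq T (f x);
  qmorb : forall x, bq S x -> bq T (f x) }.

Lemma qiso_mor (M N : zmodType) (S : subquot M) (T : subquot N) f : qiso S T f -> qmor S T f.
Proof. by case. Qed.

Lemma bqD (M : zmodType) (S : subquot M) x y : bq S x -> bq S y -> bq S (x + y).
Proof.
move=> hx hy; have h0 := bqB hy hy; rewrite subrr in h0.
by rewrite -[y]opprK -[- y]sub0r; apply: bqB => //; apply: bqB.
Qed.

Lemma bq_sym (M : zmodType) (S : subquot M) x y : bq S (x - y) -> bq S (y - x).
Proof.
move=> hx; have h0 := bqB hx hx; rewrite subrr in h0.
by rewrite -opprB -sub0r; apply: bqB.
Qed.

Lemma bq_trans (M : zmodType) (S : subquot M) y x z : bq S (x - y) -> bq S (y - z) -> bq S (x - z).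
Proof. by move=> h1 h2; have := bqD h1 h2; rewrite addrA subrK. Qed.

Lemma bq_eq (M : zmodType) (S : subquot M) x y : bq S (x - y) -> bq S y -> bq S x.
Proof. by move=> h1 h2; have := bqD h1 h2; rewrite subrK. Qed.

Variables M N P : zmodType.
Implicit Types (S : subquot M) (T : subquot N) (U : subquot P).

Lemma qmor_comp S T U f g : qmor S T f -> qmor T U g -> qmor S U (g \o f).
Proof.
case=> a1 b1 c1 [a2 b2 c2]; split=> /=.
- by move=> x y; rewrite a1 a2.
- by move=> x /b1/b2.
- by move=> x /c1/c2.
Qed.

Lemma qiso_comp S T U f g : qiso S T f -> qiso T U g -> qiso S U (g \o f).
Proof.
move=> F H; have [a b c] := qmor_comp (qiso_mor F) (qiso_mor H); split=> //=.
  by move=> x zx /= /(qiso_inj H (qisoz F zx)) /(qiso_inj F zx).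
move=> y /(qiso_surj H)[u zu bu]; have [x zx bx] := qiso_surj F zu.
exists x => //; apply: bq_trans bu _.
by rewrite -(qisoB H); exact: (qisob H).
Qed.

(** Two out of three: a class of [T] can be moved by a boundary into the image of [f], where [g] is
    known through [g \o f]. *)
Lemma qiso_cancel_right S T U f g :
  qiso S T f -> qmor T U g -> qiso S U (g \o f) -> qiso T U g.
Proof.
move=> F [a b c] GF; split=> //.
  move=> y zy bgy; have [x zx bx] := qiso_surj F zy.
  have /(qiso_inj GF zx) : bq U (g (f x)).
    apply: bq_eq bgy; apply: bq_sym; rewrite -a; exact: c.
  by move/(qisob F); exact: bq_eq.
move=> z /(qiso_surj GF)[x zx bx]; exists (f x) => //; exact: (qisoz F).
Qed.

Lemma qiso_inverse S T f g : qmor S T f -> qmor T S g ->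
  (forall x, zq S x -> bq S (g (f x) - x)) ->
  (forall y, zq T y -> bq T (f (g y) - y)) -> qiso S T f.
Proof.
case=> a b c [a' b' c'] gf fg; split=> //.
  by move=> x zx /c' bx; apply: (bq_eq (bq_sym (gf x zx))).
move=> y zy; exists (g y); [exact: b' | exact/bq_sym/fg].
Qed.

(** Maps that differ by boundaries on cycles induce the same map of subquotients, so homotopic chain
    maps may be exchanged. *)
Lemma qiso_eqmod S T f g : qiso S T f -> qmor S T g ->
  (forall x, zq S x -> bq T (g x - f x)) -> qiso S T g.
Proof.
move=> F [a b c] gf; split=> //.
  by move=> x zx bgx; apply: (qiso_inj F) => //; apply: bq_eq bgx; exact/bq_sym/gf.
move=> y /(qiso_surj F)[x zx bx]; exists x => //; apply: bq_trans bx _.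
exact/bq_sym/gf.
Qed.

End SubQuotients.

(** * Integer matrices acting on both indices of [G]-valued matrices *)

Section IntegerMatrices.
Import GRing.Theory.
Local Open Scope ring_scope.
Variable G : zmodType.

(** Matrix product on the left; [ract] is the product on the right. The two actions commute strictly
    ([lract]), so no signs are needed between the two differentials. *)
Definition lact (A A' B : finType) (f : A' -> A -> int) (c : A -> B -> G) : A' -> B -> G :=
  fun a' b => \sum_a c a b *~ f a' a.

Definition ract (A B B' : finType) (c : A -> B -> G) (g : B -> B' -> int) : A -> B' -> G :=
  fun a b' => \sum_b c a b *~ g b b'.

End IntegerMatrices.

Section IntegerMatrixTheory.
Import GRing.Theory.
Local Open Scope ring_scope.
Variable G : zmodType.

Local Notation mulz := (@ract int _ _ _).

(** Chain maps vanish outside their complex, so the identity chain map is this projector and not the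
    full identity matrix. *)
Definition idz (A : finType) (P : pred A) : A -> A -> int :=
  fun a b => ((a == b) && P a)%:R.

Lemma lactE (A A' B : finType) (f : A' -> A -> int) (c : A -> B -> G) a b :
  lact f c a b = \sum_x c x b *~ f a x.
Proof. by []. Qed.

Lemma ractE (A B B' : finType) (c : A -> B -> G) (g : B -> B' -> int) a b :
  ract c g a b = \sum_x c a x *~ g x b.
Proof. by []. Qed.

Lemma ract_assoc (A B C D : finType) (c : A -> B -> G) (f : B -> C -> int) (g : C -> D -> int) :
  ract (ract c f) g = ract c (mulz f g).
Proof.
apply/funext=> a; apply/funext=> d; rewrite /ract.
under eq_bigr => x _ do rewrite mulrz_suml.
rewrite exchange_big; apply: eq_bigr => b _; rewrite mulrz_sumr.
by apply: eq_bigr => x _; rewrite mulrzz mulrzA.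
Qed.

Lemma lact_assoc (A B C D : finType) (f : A -> B -> int) (g : B -> C -> int) (c : C -> D -> G) :
  lact f (lact g c) = lact (mulz f g) c.
Proof.
apply/funext=> a; apply/funext=> d; rewrite /ract /lact.
under eq_bigr => x _ do rewrite mulrz_suml.
rewrite exchange_big; apply: eq_bigr => b _; rewrite mulrz_sumr.
by apply: eq_bigr => x _; rewrite mulrzz -mulrzA mulrC.
Qed.

Lemma lract (A B C D : finType) (f : A -> B -> int) (c : B -> C -> G) (g : C -> D -> int) :
  lact f (ract c g) = ract (lact f c) g.
Proof.
apply/funext=> a; apply/funext=> d; rewrite /ract /lact.
under eq_bigr => x _ do rewrite mulrz_suml.
under [RHS]eq_bigr => x _ do rewrite mulrz_suml.
rewrite exchange_big; apply: eq_bigr => c' _; apply: eq_bigr => b _.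
by rewrite -!mulrzA mulrC.
Qed.

Lemma lactB (A A' B : finType) (f : A' -> A -> int) (c d : A -> B -> G) :
  lact f (c - d) = lact f c - lact f d.
Proof.
apply/funext=> a; apply/funext=> b; rewrite !fctE /lact -sumrB.
by apply: eq_bigr => x _; rewrite mulrzBl.
Qed.

Lemma lactD (A A' B : finType) (f : A' -> A -> int) (c d : A -> B -> G) :
  lact f (c + d) = lact f c + lact f d.
Proof.
apply/funext=> a; apply/funext=> b; rewrite !fctE /lact -big_split.
by apply: eq_bigr => x _; rewrite mulrzDl.
Qed.

Lemma lact0 (A A' B : finType) (f : A' -> A -> int) : lact f (0 : A -> B -> G) = 0.
Proof. by rewrite -(subrr (0 : A -> B -> G)) lactB subrr. Qed.

Lemma ractB (A B B' : finType) (f : B -> B' -> int) (c d : A -> B -> G) :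
  ract (c - d) f = ract c f - ract d f.
Proof.
apply/funext=> a; apply/funext=> b; rewrite !fctE /ract -sumrB.
by apply: eq_bigr => x _; rewrite mulrzBl.
Qed.

Lemma ractD (A B B' : finType) (f : B -> B' -> int) (c d : A -> B -> G) :
  ract (c + d) f = ract c f + ract d f.
Proof.
apply/funext=> a; apply/funext=> b; rewrite !fctE /ract -big_split.
by apply: eq_bigr => x _; rewrite mulrzDl.
Qed.

Lemma ract0 (A B B' : finType) (f : B -> B' -> int) : ract (0 : A -> B -> G) f = 0.
Proof. by rewrite -(subrr (0 : A -> B -> G)) ractB subrr. Qed.

Lemma lactBm (A A' B : finType) (f g : A' -> A -> int) (c : A -> B -> G) :
  lact (f - g) c = lact f c - lact g c.
Proof.
apply/funext=> a; apply/funext=> b; rewrite !fctE /lact -sumrB.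
by apply: eq_bigr => x _; rewrite !fctE mulrzBr.
Qed.

Lemma lactDm (A A' B : finType) (f g : A' -> A -> int) (c : A -> B -> G) :
  lact (f + g) c = lact f c + lact g c.
Proof.
apply/funext=> a; apply/funext=> b; rewrite !fctE /lact -big_split.
by apply: eq_bigr => x _; rewrite !fctE mulrzDr.
Qed.

Lemma ractBm (A B B' : finType) (f g : B -> B' -> int) (c : A -> B -> G) :
  ract c (f - g) = ract c f - ract c g.
Proof.
apply/funext=> a; apply/funext=> b; rewrite !fctE /ract -sumrB.
by apply: eq_bigr => x _; rewrite !fctE mulrzBr.
Qed.

Lemma ractDm (A B B' : finType) (f g : B -> B' -> int) (c : A -> B -> G) :
  ract c (f + g) = ract c f + ract c g.
Proof.
apply/funext=> a; apply/funext=> b; rewrite !fctE /ract -big_split.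
by apply: eq_bigr => x _; rewrite !fctE mulrzDr.
Qed.

Lemma ract0m (A B B' : finType) (c : A -> B -> G) : ract c (0 : B -> B' -> int) = 0.
Proof. by rewrite -(subrr (0 : B -> B' -> int)) ractBm subrr. Qed.

Lemma lact_id (A B : finType) (P : pred A) (c : A -> B -> G) :
  (forall a b, c a b != 0 -> P a) -> lact (idz P) c = c.
Proof.
move=> h; apply/funext=> a; apply/funext=> b; rewrite /lact (bigD1 a) //= big1 ?addr0.
  rewrite /idz eqxx /=; case: (boolP (P a)) => //= nP.
  by have [->|/h] := eqVneq (c a b) 0; rewrite ?mul0rz // (negbTE nP).
by move=> x nx; rewrite /idz eq_sym (negbTE nx) mulr0z.
Qed.

Lemma ract_id (A B : finType) (P : pred B) (c : A -> B -> G) :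
  (forall a b, c a b != 0 -> P b) -> ract c (idz P) = c.
Proof.
move=> h; apply/funext=> a; apply/funext=> b; rewrite /ract (bigD1 b) //= big1 ?addr0.
  rewrite /idz eqxx /=; case: (boolP (P b)) => //= nP.
  by have [->|/h] := eqVneq (c a b) 0; rewrite ?mul0rz // (negbTE nP).
by move=> x nx; rewrite /idz (negbTE nx) mulr0z.
Qed.

Lemma sum_neq0 (I : finType) (F : I -> G) : \sum_i F i != 0 -> exists i, F i != 0.
Proof.
move=> h; apply: contrapT => /forallNP H; move/eqP: h; apply.
by apply: big1 => i _; apply/eqP/negPn/negP; exact: H.
Qed.

Lemma lact_neq0 (A A' B : finType) (f : A' -> A -> int) (c : A -> B -> G) a' b :
  lact f c a' b != 0 -> exists a, c a b != 0 /\ f a' a != 0.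
Proof.
case/sum_neq0=> a h; exists a; split; apply: contra_neq h => ->; by rewrite ?mul0rz ?mulr0z.
Qed.

Lemma ract_neq0 (A B B' : finType) (f : B -> B' -> int) (c : A -> B -> G) a b' :
  ract c f a b' != 0 -> exists b, c a b != 0 /\ f b b' != 0.
Proof.
case/sum_neq0=> a0 h; exists a0; split; apply: contra_neq h => ->; by rewrite ?mul0rz ?mulr0z.
Qed.

End IntegerMatrixTheory.

(** * Incidence numbers of a simplex *)

Notation mulz := (@ract int _ _ _).

Section Incidence.
Import GRing.Theory.
Local Open Scope ring_scope.
Variable V : finType.
Implicit Types (x y v : V) (s t r : {set V}).

Definition sgnz v s : int := (-1) ^+ #|[set u in s | vless u v]|.

Definition face v s t : int := if (v \notin s) && (t == v |: s) then sgnz v s else 0.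

(** The transpose of [face v]. With columns as sources, [face v] removes [v] and [cone v] adjoins
    it. *)
Definition cone v t s : int := face v s t.

(** Incidence matrix of the full simplex on [V], empty set included: acting on the left it is d, on
    the right delta. *)
Definition inc s t : int := \sum_v face v s t.

Lemma vless_total x y : x != y -> vless x y = ~~ vless y x.
Proof.
move=> nxy; rewrite /vless -leqNgt ltn_neqAle; case: eqP => //= e.
by rewrite (enum_rank_inj (val_inj e)) eqxx in nxy.
Qed.

Lemma sgnz2 v s : sgnz v s * sgnz v s = 1.
Proof. by rewrite /sgnz -expr2 sqrr_sign. Qed.

Lemma sgnzU x y s : x \notin s -> sgnz y (x |: s) = (-1) ^+ (vless x y) * sgnz y s.
Proof.
move=> xs; rewrite /sgnz -exprD; congr (_ ^+ _).
have -> : [set u in x |: s | vless u y] =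
   (if vless x y then [set x] else set0) :|: [set u in s | vless u y].
  apply/setP=> u; rewrite !inE; case: (eqVneq u x) => [->|nux] /=.
    by case: ifP; rewrite !inE ?eqxx ?(negbTE xs).
  by case: ifP; rewrite !inE ?(negbTE nux).
case: ifP => _; last by rewrite set0U.
by rewrite cardsU1 !inE (negbTE xs).
Qed.

Lemma mul_face x y s t : mulz (face x) (face y) s t =
  if [&& x \notin s, y \notin x |: s & t == y |: (x |: s)]
  then sgnz x s * sgnz y (x |: s) else 0.
Proof.
rewrite ractE; under eq_bigr => r _ do rewrite mulrzz.
rewrite (bigD1 (x |: s)) //= big1 ?addr0.
  rewrite /face eqxx andbT; case: ifP => //= _; last by rewrite mul0r.
  by case: ifP => //; rewrite mulr0.
by move=> r nr; rewrite /face (negbTE nr) andbF mul0r.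
Qed.

(** In the two orders only the sign contributed by one vertex to the other changes, and exactly one
    of [vless x y] and [vless y x] holds. *)
Lemma face_anti x y s t : mulz (face x) (face y) s t = - mulz (face y) (face x) s t.
Proof.
rewrite !mul_face; have [->|nxy] := eqVneq x y; first by rewrite !inE eqxx /= !andbF oppr0.
rewrite !inE !negb_or (eq_sym y x) nxy /=.
case xs: (x \in s) => /=; first by rewrite andbF oppr0.
case ys: (y \in s) => /=; first by rewrite oppr0.
rewrite setUCA; case: ifP => _; last by rewrite oppr0.
rewrite !sgnzU ?xs ?ys // (vless_total nxy); case: vless => /=; ring.
Qed.

Lemma incE s t : inc s t = \sum_v face v s t. Proof. by []. Qed.

(** Summing [face_anti] over all pairs of vertices gives S = -S in the integers. *)
Lemma inc_inc s t : mulz inc inc s t = 0.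
Proof.
pose S := mulz inc inc s t.
suff : S = - S by rewrite /S; lia.
have -> : S = \sum_x \sum_y mulz (face x) (face y) s t.
  rewrite /S ractE.
  under eq_bigr => r _.
    rewrite mulrzz !incE big_distrlr /=.
    over.
  rewrite exchange_big; apply: eq_bigr => x _.
  rewrite exchange_big; apply: eq_bigr => y _.
  by rewrite ractE; apply: eq_bigr => r _; rewrite mulrzz.
rewrite -sumrN exchange_big; apply: eq_bigr => x _; rewrite -sumrN.
by apply: eq_bigr => y _; rewrite face_anti.
Qed.

Lemma mul_face_cone x y s t : mulz (face y) (cone x) s t =
  if [&& y \notin s, x \notin t & y |: s == x |: t] then sgnz y s * sgnz x t else 0.
Proof.
rewrite ractE; under eq_bigr => r _ do rewrite mulrzz.
rewrite (bigD1 (y |: s)) //= big1 ?addr0.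
  rewrite /cone /face eqxx andbT; case: ifP => //= _; last by rewrite mul0r.
  by case: ifP => //; rewrite mulr0.
by move=> r nr; rewrite /face (negbTE nr) andbF mul0r.
Qed.

Lemma mul_cone_face x y s t : mulz (cone x) (face y) s t =
  if [&& x \in s, y \notin s :\ x & t == y |: (s :\ x)]
  then sgnz x (s :\ x) * sgnz y (s :\ x) else 0.
Proof.
rewrite ractE; under eq_bigr => r _ do rewrite mulrzz.
rewrite (bigD1 (s :\ x)) //= big1 ?addr0.
  rewrite /cone /face !inE eqxx /=; case: (boolP (x \in s)) => xs /=.
    by rewrite setD1K // eqxx; case: ifP => //; rewrite mulr0.
  case: ifP => [/eqP e|_]; last by rewrite mul0r.
  by rewrite e !inE eqxx in xs.
move=> r nr; rewrite /cone /face; case: ifP => [/andP[xr /eqP e]|_]; last by rewrite mul0r.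
by rewrite e setU1K ?eqxx in nr.
Qed.

(** Canonical anticommutation relations: adding [x] and removing [y] anticommute for [x != y]. For
    [x = y] at most one composite is nonzero, depending on whether [x \in s], and the signs square
    to 1. *)
Lemma cone_face x y s t :
  mulz (face y) (cone x) s t + mulz (cone x) (face y) s t = ((x == y) && (s == t))%:R.
Proof.
rewrite mul_face_cone mul_cone_face; have [<-|nxy] /= := eqVneq x y.
  rewrite !inE eqxx /=; case: (boolP (x \in s)) => xs /=.
    by rewrite setD1K // add0r eq_sym sgnz2; case: eqP.
  rewrite addr0; case: (boolP (x \in t)) => xt /=.
    by case: eqP xs => // ->; rewrite xt.
  have -> : (x |: s == x |: t) = (s == t).
    by apply/eqP/eqP => [e|->//]; rewrite -(setU1K xs) e setU1K.
  by case: eqP => // ->; rewrite sgnz2.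
rewrite !inE ?[y == x]eq_sym (negbTE nxy) /=.
set b1 := [&& _, _ & _]; set b2 := [&& _, _ & _].
(* Both composites are nonzero at the same pairs; only the signs remain to be compared. *)
have eb : b1 = b2.
  apply/and3P/and3P => [[ys xt /eqP e]|[xs ys /eqP e]].
    have xs : x \in s.
      by have : x \in x |: t by [rewrite !inE eqxx]; rewrite -e !inE (negbTE nxy).
    split=> //; rewrite -(setU1K xt) -e; apply/eqP/setP=> u; rewrite !inE.
    by case: (eqVneq u y) => //= ->; rewrite eq_sym nxy.
  split=> //; first by rewrite e !inE eqxx (negbTE nxy).
  rewrite e; apply/eqP/setP=> u; rewrite !inE.
  by case: (eqVneq u x) => //= ->; rewrite xs orbT.
rewrite eb; case: ifP => [/and3P[xs ys /eqP ->]|]; last by rewrite addr0.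
have xsx : x \notin s :\ x by rewrite !inE eqxx.
have ysx : y \notin s :\ x by rewrite !inE negb_and ys orbT.
rewrite -{1}(setD1K xs) !sgnzU // (vless_total nxy).
by case: vless => /=; ring.
Qed.

(** Only [y = x] survives when [cone_face] is summed over [y]: coning with apex [x] contracts the
    augmented chain complex of the full simplex. *)
Lemma inc_cone x s t : mulz inc (cone x) s t + mulz (cone x) inc s t = (s == t)%:R.
Proof.
have -> : mulz inc (cone x) s t = \sum_y mulz (face y) (cone x) s t.
  rewrite ractE; under eq_bigr => r _ do rewrite mulrzz incE mulr_suml.
  by rewrite exchange_big; apply: eq_bigr => y _; rewrite ractE; apply: eq_bigr => r _; rewrite mulrzz.
have -> : mulz (cone x) inc s t = \sum_y mulz (cone x) (face y) s t.
  rewrite ractE; under eq_bigr => r _ do rewrite mulrzz incE mulr_sumr.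
  by rewrite exchange_big; apply: eq_bigr => y _; rewrite ractE; apply: eq_bigr => r _; rewrite mulrzz.
rewrite -big_split /=; under eq_bigr => y _ do rewrite cone_face.
rewrite (bigD1 x) //= eqxx /= big1 ?addr0 // => y; rewrite eq_sym => /negbTE ->.
by [].
Qed.

Lemma inc_neq0 s t : inc s t != 0 -> exists v, v \notin s /\ t = v |: s.
Proof.
case/sum_neq0=> v; rewrite /face; case: ifP => [/andP[? /eqP ?] _|_]; last by rewrite eqxx.
by exists v.
Qed.

Lemma cone_neq0 v t s : cone v t s != 0 -> v \notin s /\ t = v |: s.
Proof.
by rewrite /cone /face; case: ifP => [/andP[? /eqP ?] _|_]; rewrite ?eqxx.
Qed.

End Incidence.

(** * Acyclic carriers *)

Section Carriers.
Import GRing.Theory.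
Local Open Scope ring_scope.

Lemma mulzE (A B C : finType) (f : A -> B -> int) (g : B -> C -> int) a c :
  mulz f g a c = \sum_b f a b * g b c.
Proof. by rewrite ractE; apply: eq_bigr => b _; rewrite mulrzz. Qed.

Lemma mulz_neq0 (A B C : finType) (f : A -> B -> int) (g : B -> C -> int) a c :
  mulz f g a c != 0 -> exists b, f a b != 0 /\ g b c != 0.
Proof. exact: ract_neq0. Qed.

(** Each factor matters only where the other is nonzero; this is how the truncated matrix [bd] is
    traded for [inc]. *)
Lemma eq_mulz (A B C : finType) (f f' : A -> B -> int) (g g' : B -> C -> int) a c :
  (forall b, g b c != 0 -> f a b = f' a b) ->
  (forall b, f' a b != 0 -> g b c = g' b c) -> mulz f g a c = mulz f' g' a c.
Proof.
move=> h1 h2; rewrite !mulzE; apply: eq_bigr => b _.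
have [z|/h1 ->] := eqVneq (g b c) 0; last first.
  by have [->|/h2 ->] := eqVneq (f' a b) 0; rewrite ?mul0r.
rewrite z mulr0; have [->|/h2 <-] := eqVneq (f' a b) 0; first by rewrite mul0r.
by rewrite z mulr0.
Qed.

Lemma inc_inc0 (V : finType) : mulz (@inc V) (@inc V) = 0.
Proof. by apply/funext=> s; apply/funext=> t; rewrite inc_inc. Qed.

Lemma inc_card (V : finType) (s t : {set V}) :
  inc s t != 0 -> s \subset t /\ #|t| = #|s|.+1.
Proof. by case/inc_neq0=> v [vs ->]; rewrite cardsU1 vs subsetUr. Qed.

Definition scalez (A B : finType) (e : int) (m : A -> B -> int) := fun a b => e * m a b.

Lemma mulz_scaler (A B C : finType) e (f : A -> B -> int) (g : B -> C -> int) :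
  mulz f (scalez e g) = scalez e (mulz f g).
Proof.
apply/funext=> a; apply/funext=> c; rewrite /scalez !mulzE mulr_sumr.
by apply: eq_bigr => b _; rewrite mulrCA.
Qed.

Lemma mulz_scalel (A B C : finType) e (f : A -> B -> int) (g : B -> C -> int) :
  mulz (scalez e f) g = scalez e (mulz f g).
Proof.
apply/funext=> a; apply/funext=> c; rewrite /scalez !mulzE mulr_sumr.
by apply: eq_bigr => b _; rewrite mulrA.
Qed.

Lemma mulz0 (A B C : finType) (f : A -> B -> int) : mulz f (0 : B -> C -> int) = 0.
Proof. exact: ract0m. Qed.

Lemma mul0z (A B C : finType) (f : B -> C -> int) : mulz (0 : A -> B -> int) f = 0.
Proof. exact: ract0. Qed.

Section Solve.
Variables (V V' : finType) (K : {set {set V}}) (n : nat) (e : int).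
Variables (r : {set V'} -> {set V} -> int) (h0 : {set V'} -> int).
Variables (Phi : {set V'} -> {set V} -> Prop).

(* One recursion serves both the construction of chain maps (e = 1, r = 0) and of chain
   homotopies (e = -1, r the difference of two chain maps). *)
Lemma carrier_solve : is_complex K -> e * e = 1 ->
  (forall s' s, s \in K -> r s' s != 0 -> Phi s' s /\ #|s'|.+1 = (#|s| + n)%N) ->
  (forall s' s, s \in K -> mulz (@inc _) r s' s + e * mulz r (@inc _) s' s = 0) ->
  (forall s', h0 s' != 0 -> Phi s' set0 /\ #|s'| = n) ->
  (forall s', \sum_t' inc s' t' * h0 t' = r s' set0) ->
  (forall s, s \in K -> s != set0 ->
     exists v, forall s', Phi s' s -> Phi (v |: s') s) ->
  (forall s' (s t : {set V}), t \in K -> s \subset t -> Phi s' s -> Phi s' t) ->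
  exists h : {set V'} -> {set V} -> int,
    [/\ forall s' s, h s' s != 0 -> [/\ s \in K, Phi s' s & #|s'| = (#|s| + n)%N],
        forall s', h s' set0 = h0 s' &
        forall s' s, s \in K ->
          mulz (@inc _) h s' s = r s' s + e * mulz h (@inc _) s' s].
Proof.
move=> [K0 Kdown] ee rP rD h0P h0D Phicone Phimono.
(* [k s] cones off the carrier of [s]; the zero matrix is a default outside [K] and at the empty
   simplex. *)
have /choice[k kP] : forall s : {set V}, exists m : {set V'} -> {set V'} -> int,
    s \in K -> s != set0 ->
    exists2 v, m = cone v & forall s', Phi s' s -> Phi (v |: s') s.
  move=> s; have [sK|_] := boolP (s \in K); last by exists 0.
  have [_|nz] := eqVneq s set0; first by exists 0.
  by have [v vP] := Phicone _ sK nz; exists (cone v) => _ _; exists v.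
(* The equation is solved column by column, in the order of cardinality. *)
suff H N : exists h : {set V'} -> {set V} -> int,
    [/\ forall s' s, h s' s != 0 -> [/\ s \in K, Phi s' s & #|s'| = (#|s| + n)%N],
        forall s', h s' set0 = h0 s' &
        forall s' s, s \in K -> (#|s| <= N)%N ->
          mulz (@inc _) h s' s = r s' s + e * mulz h (@inc _) s' s].
  have [h [h1 h2 h3]] := H #|V|; exists h; split=> // s' s sK.
  by apply: h3 => //; exact: max_card.
elim: N => [|N [h [h1 h2 h3]]].
  exists (fun s' (s : {set V}) => if s == set0 then h0 s' else 0); split.
  - move=> s' s; case: (eqVneq s set0) => [->|_]; last by rewrite eqxx.
    by move/h0P=> [p1 p2]; rewrite cards0.
  - by move=> s'; rewrite eqxx.
  - move=> s' s sK; rewrite leqn0 cards_eq0 => /eqP ->.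
    rewrite !mulzE [X in _ + e * X]big1 ?mulr0 ?addr0.
      by rewrite -h0D; apply: eq_bigr => t' _; rewrite eqxx.
    move=> t _; have [->|/inc_card[_]] := eqVneq (inc t set0) 0; first by rewrite mulr0.
    by rewrite cards0.
(* The boundary that the next columns of the solution must have. *)
pose W := r + scalez e (mulz h (@inc _)).
have WP s' (s : {set V}) : s \in K -> W s' s != 0 -> Phi s' s /\ #|s'|.+1 = (#|s| + n)%N.
  move=> sK; rewrite /W !fctE /scalez; have [rz|/(rP _ _ sK)//] := eqVneq (r s' s) 0.
  rewrite rz add0r mulf_eq0 negb_or => /andP[_ /mulz_neq0[t [/h1[tK p c]]]].
  move=> /inc_card[st ct]; split; first exact: Phimono p.
  by rewrite c ct addSn.
(* The columns of cardinality [N.+1] are redefined as the cone over [W]; the others are kept. *)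
exists (fun s' (s : {set V}) => if (#|s| == N.+1) && (s \in K) then mulz (k s) W s' s else h s' s).
set h' := fun s' s => _.
have hle s' (s : {set V}) : (#|s| <= N)%N -> h' s' s = h s' s.
  by move=> c; rewrite /h' ltn_eqF ?ltnS.
have h'inc s' (s : {set V}) : (#|s| <= N.+1)%N -> mulz h' (@inc _) s' s = mulz h (@inc _) s' s.
  move=> cs; apply: eq_mulz => // t /inc_card[_ ct]; apply: hle; lia.
split.
- move=> s' s; rewrite /h'; case: ifP => [/andP[/eqP cs sK]|_]; last exact: h1.
  have [|v -> vP] := kP s sK; first by rewrite -card_gt0 cs.
  move=> /mulz_neq0[t' [/cone_neq0[at' ->] /(WP _ _ sK)[p c]]]; split=> //; first exact: vP.
  by rewrite cardsU1 at' add1n.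
- by move=> s'; rewrite -h2; apply: hle; rewrite cards0.
move=> s' s sK cs; rewrite h'inc //.
move: cs; rewrite leq_eqVlt => /predU1P[cs|]; last first.
  rewrite ltnS => cs; rewrite -h3 //; apply: eq_mulz => // t' _.
  exact: hle.
have [|v kE _] := kP s sK; first by rewrite -card_gt0 cs.
have -> : mulz (@inc _) h' s' s = mulz (@inc _) (mulz (cone v) W) s' s.
  by apply: eq_mulz => // t' _; rewrite /h' cs eqxx sK kE.
(* By [inc_cone], d(cone W) = W - cone(d W), so it remains to see that [W] is a cycle. *)
have -> : mulz (@inc _) (mulz (cone v) W) =
   W - mulz (cone v) (mulz (@inc _) W).
  rewrite -!ract_assoc; apply/funext=> x; apply/funext=> y; rewrite !fctE.
  apply: (canRL (addrK _)); rewrite ![mulz (mulz _ _) _ _ _]mulzE -big_split (bigD1 x) //=.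
  rewrite -mulrDl inc_cone eqxx mul1r big1 ?addr0 // => t' /negbTE nt.
  by rewrite -mulrDl inc_cone eq_sym nt mul0r.
rewrite -[LHS]/(W s' s - mulz (cone v) (mulz (@inc _) W) s' s) [X in _ - X]mulzE [X in _ - X]big1 ?subr0 //.
move=> t' _; suff -> : mulz (@inc _) W t' s = 0 by rewrite mulr0.
rewrite /W ractDm !fctE mulz_scaler /scalez -[RHS](rD t' s) //; congr (_ + e * _).
rewrite -ract_assoc.
(* On the facets of [s] the induction hypothesis replaces d h by [W]; the part of [W] containing [h]
   then dies by [inc_inc0], and [rD] cancels the rest. *)
have -> : mulz (mulz (@inc _) h) (@inc _) t' s = mulz W (@inc _) t' s.
  apply: eq_mulz => // t /inc_card[st ct]; rewrite /W !fctE /scalez h3 //.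
    exact: Kdown st.
  by lia.
by rewrite /W ractD mulz_scalel ract_assoc inc_inc0 mulz0 !fctE /scalez mulr0 addr0.
Qed.

End Solve.

End Carriers.

(** * Chain maps and homotopies with prescribed carriers *)

Section ChainMaps.
Import GRing.Theory.
Local Open Scope ring_scope.

(** [inc] truncated to [K]. For [red = false] the row of the empty simplex is dropped as well, so
    that vertices have zero boundary. *)
Definition bd (V : finType) (K : {set {set V}}) (red : bool) (s t : {set V}) : int :=
  if (t \in K) && (red || (s != set0)) then inc s t else 0.

(** Columns are sources: [f] goes from chains of [K] to chains of [K'], and [Phi s' s] means that
    [s'] lies in the carrier of [s]. The clause [cm0] normalizes the augmentation. *)
Record chain_map (V V' : finType) (K : {set {set V}}) (K' : {set {set V'}})
    (Phi : {set V'} -> {set V} -> Prop) (f : {set V'} -> {set V} -> int) : Prop :=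
  ChainMap {
  cmP : forall (s' : {set V'}) (s : {set V}), f s' s != 0 ->
    [/\ s \in K, s' \in K', #|s'| = #|s| & Phi s' s];
  cmD : forall (s' : {set V'}) (s : {set V}), s \in K ->
    mulz (@inc _) f s' s = mulz f (@inc _) s' s;
  cm0 : f set0 set0 = 1 }.

(** The homotopy vanishes on the empty simplex, so that it also serves the unreduced complex. *)
Definition chain_htpy (V V' : finType) (K : {set {set V}}) (K' : {set {set V'}})
    (Phi : {set V'} -> {set V} -> Prop) (f g : {set V'} -> {set V} -> int) : Prop :=
  exists h : {set V'} -> {set V} -> int,
   (forall (s' : {set V'}) (s : {set V}), h s' s != 0 ->
      [/\ s \in K, s' \in K', #|s'| = #|s|.+1, Phi s' s & s != set0]) /\
   (forall (s' : {set V'}) (s : {set V}), s \in K ->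
      f s' s - g s' s = mulz (@inc _) h s' s + mulz h (@inc _) s' s).

Section OneMap.
Variables (V V' : finType) (K : {set {set V}}) (K' : {set {set V'}}).
Variable (Phi : {set V'} -> {set V} -> Prop).

(** Chain maps preserve cardinality, so dropping the empty simplex affects source and target
    alike. *)
Lemma chain_map_bd f red : chain_map K K' Phi f ->
  mulz (bd K' red) f = mulz f (bd K red).
Proof.
case=> fP fD f0; apply/funext=> s'; apply/funext=> s.
have [sK|nsK] := boolP (s \in K); last first.
  rewrite !mulzE !big1 // => t _; first by rewrite /bd (negbTE nsK) mulr0.
  have [->|/fP[]] := eqVneq (f t s) 0; first by rewrite mulr0.
  by rewrite (negbTE nsK).
have [rs|nrs] := boolP (red || (s' != set0)).
  have -> : mulz (bd K' red) f s' s = mulz (@inc _) f s' s.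
    by apply: eq_mulz => // t /fP[_ tK _ _]; rewrite /bd tK rs.
  rewrite fD //; apply: eq_mulz => // t /fP[_ _ c _]; rewrite /bd sK /=.
  by case/orP: rs => [-> // | nz]; rewrite -card_gt0 -c card_gt0 nz orbT.
case/norP: nrs => /negbTE -> /negPn/eqP ->.
rewrite !mulzE !big1 // => t _; last by rewrite /bd eqxx andbF mul0r.
have [->|/fP[_ _]] := eqVneq (f set0 t) 0; first by rewrite mul0r.
by rewrite cards0 => /esym/eqP; rewrite cards_eq0 => /eqP -> _; rewrite /bd eqxx andbF mulr0.
Qed.

Lemma chain_htpy_bd f g red : chain_map K K' Phi f -> chain_map K K' Phi g ->
  chain_htpy K K' Phi f g -> exists h : {set V'} -> {set V} -> int,
   (forall (s' : {set V'}) (s : {set V}), h s' s != 0 ->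
      [/\ s \in K, s' \in K', #|s'| = #|s|.+1 & Phi s' s /\ s != set0]) /\
   f - g = mulz (bd K' red) h + mulz h (bd K red).
Proof.
move=> cf cg [h [hP hE]]; exists h; split; first by move=> s' s /hP[].
apply/funext=> s'; apply/funext=> s; rewrite !fctE.
have [sK|nsK] := boolP (s \in K); last first.
  rewrite !mulzE !big1 ?addr0; first last.
  - move=> t _; have [->|/hP[]] := eqVneq (h t s) 0; first by rewrite mulr0.
    by rewrite (negbTE nsK).
  - by move=> t _; rewrite /bd (negbTE nsK) mulr0.
  have [->|/(cmP cf)[]] := eqVneq (f s' s) 0; last by rewrite (negbTE nsK).
  have [->|/(cmP cg)[]] := eqVneq (g s' s) 0; last by rewrite (negbTE nsK).
  by rewrite subrr.
rewrite hE //.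
have -> : mulz h (bd K red) s' s = mulz h (@inc _) s' s.
  apply: eq_mulz => // t; last by rewrite /bd sK /=; move=> /hP[_ _ _ _ ->]; rewrite orbT.
congr (_ + _); apply: eq_mulz => // t /hP[_ tK ct _ nz]; rewrite /bd tK /=; case: ifP => // /norP[_ /negPn/eqP ->].
apply/eqP/negPn/negP => /inc_card[_]; rewrite ct cards0 => -[] /eqP.
by rewrite cards_eq0 (negbTE nz).
Qed.

Hypothesis cK : is_complex K.
Hypothesis PhiK : forall s' s, Phi s' s -> s' \in K'.
Hypothesis Phimono : forall s' (s t : {set V}), t \in K -> s \subset t -> Phi s' s -> Phi s' t.
Hypothesis Phicone : forall s : {set V}, s \in K -> s != set0 ->
  exists v, forall s', Phi s' s -> Phi (v |: s') s.

(** Uniqueness half of the acyclic carrier theorem. The two maps agree on the empty simplex by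
    [cm0], so the homotopy starts from zero. *)
Lemma carrier_htpy f g : chain_map K K' Phi f -> chain_map K K' Phi g ->
  chain_htpy K K' Phi f g.
Proof.
move=> cf cg.
have key s' (s : {set V}) : f s' s - g s' s != 0 -> #|s'| = #|s| /\ Phi s' s.
  have [->|/(cmP cf)[]//] := eqVneq (f s' s) 0.
  by rewrite sub0r oppr_eq0 => /(cmP cg)[].
case: (@carrier_solve V V' K 1 (-1) (f - g) (fun=> 0) Phi) => //.
- by move=> s' s sK /key[-> p]; rewrite addn1.
- move=> s' s sK; rewrite ractBm ractB; rewrite mulN1r; apply/eqP; rewrite subr_eq0; apply/eqP.
  by congr (_ - _); [exact: (cmD cf) | exact: (cmD cg)].
- move=> s'; rewrite big1; last by move=> t _; rewrite mulr0.
  rewrite !fctE; apply/esym/eqP/negPn/negP => h; have [/eqP] := key _ _ h.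
  rewrite cards0 cards_eq0 => /eqP e _; move: h.
  by rewrite e (cm0 cf) (cm0 cg) subrr eqxx.
move=> h [hP h0 hE]; exists h; split.
  move=> s' s nz; have [sK p c] := hP _ _ nz; split=> //; first exact: PhiK p.
    by rewrite c addn1.
  by apply: contra_neq nz => ->; rewrite h0.
move=> s' s sK; rewrite hE // !fctE; ring.
Qed.

(** Existence half; the recursion starts by sending the empty simplex to itself. *)
Lemma carrier_map : Phi set0 set0 -> exists f, chain_map K K' Phi f.
Proof.
move=> Phi0.
case: (@carrier_solve V V' K 0 1 0 (fun s => (s == set0)%:R) Phi) => //.
- by move=> s' s sK; rewrite mulz0 mul0z addr0.
- by move=> s'; have [->|_ /eqP//] := eqVneq s' set0; rewrite cards0.
- move=> s'; rewrite big1 // => t _; have [->|_] := eqVneq t set0; last by rewrite mulr0.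
  have [->|/inc_card[_]] := eqVneq (inc s' set0) 0; first by rewrite mul0r.
  by rewrite cards0.
move=> h [hP h0 hE]; exists h; split.
- by move=> s' s /hP[sK p c]; split; rewrite ?c ?addn0 //; exact: PhiK p.
- by move=> s' s sK; rewrite hE // add0r mul1r.
- by rewrite h0 eqxx.
Qed.

End OneMap.

Lemma chain_map_id (V : finType) (K : {set {set V}}) (Phi : {set V} -> {set V} -> Prop) :
  is_complex K -> (forall s, s \in K -> Phi s s) -> chain_map K K Phi (idz (fun s => s \in K)).
Proof.
move=> [K0 Kd] h; split.
- move=> s' s; rewrite /idz; case: (eqVneq s' s) => [->|_]; last by rewrite eqxx.
  by rewrite /=; case: (boolP (s \in K)) => [sK _|_]; rewrite ?eqxx //; split=> //; exact: h.
- move=> s' s sK.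
  have -> : mulz (@inc _) (idz (fun s => s \in K)) s' s = inc s' s.
    rewrite mulzE (bigD1 s) //= big1 ?addr0; first by rewrite /idz eqxx /= sK mulr1.
    by move=> t /negbTE nt; rewrite /idz nt mulr0.
  rewrite mulzE (bigD1 s') //= big1 ?addr0.
    rewrite /idz eqxx /=.
    have [->|/inc_card[/(Kd _ _ sK) -> _]] := eqVneq (inc s' s) 0; first by rewrite mulr0.
    by rewrite mul1r.
  by move=> t; rewrite /idz eq_sym => /negbTE ->; rewrite mul0r.
- by rewrite /idz eqxx /= K0.
Qed.

Lemma chain_map_comp (V V' V'' : finType) (K : {set {set V}}) (K' : {set {set V'}})
   (K'' : {set {set V''}}) Phi Psi Theta f g :
  chain_map K K' Phi f -> chain_map K' K'' Psi g ->
  (forall s'' s' s, Psi s'' s' -> Phi s' s -> Theta s'' s) ->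
  chain_map K K'' Theta (mulz g f).
Proof.
move=> cf cg h; split.
- move=> s'' s /mulz_neq0[s' [/(cmP cg)[h1 h2 h3 h4] /(cmP cf)[h5 h6 h7 h8]]].
  by split=> //; [rewrite h3 | exact: h h4 h8].
- move=> s'' s sK; rewrite [in RHS]ract_assoc.
  have -> : mulz (@inc _) (mulz g f) s'' s = mulz (mulz g (@inc _)) f s'' s.
    rewrite -ract_assoc; apply: eq_mulz => // t /(cmP cf)[_ tK _ _]; exact: (cmD cg).
  rewrite ract_assoc; apply: eq_mulz => // t _; exact: (cmD cf).
- rewrite mulzE (bigD1 set0) //= big1 ?addr0 ?(cm0 cf) ?(cm0 cg) //.
  move=> t nz; have [->|/(cmP cf)[_ _]] := eqVneq (f t set0) 0; first by rewrite mulr0.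
  by rewrite cards0 => /eqP; rewrite cards_eq0 (negbTE nz).
Qed.

Lemma chain_map_weaken (V V' : finType) (K : {set {set V}}) (K' : {set {set V'}})
    (Phi Psi : {set V'} -> {set V} -> Prop) f :
  chain_map K K' Phi f ->
  (forall s' s, s' \in K' -> s \in K -> Phi s' s -> Psi s' s) -> chain_map K K' Psi f.
Proof.
by move=> cf h; split; [move=> s' s /(cmP cf)[? ? ? ?]; split=> //; exact: h
 | exact: (cmD cf) | exact: (cm0 cf)].
Qed.

End ChainMaps.

(** * The double complex of a pair of complexes *)

Section DoubleComplexes.
Import GRing.Theory.
Local Open Scope ring_scope.
Variable G : zmodType.

Section OneDoubleComplex.
Variables (V1 V2 : finType) (K1 : {set {set V1}}) (K2 : {set {set V2}}) (red : bool).
Variable rel : {set V1} -> {set V2} -> Prop.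
Implicit Types (i j : int) (c y w : {set V1} -> {set V2} -> G).

Definition cell s t := [/\ s \in K1, t \in K2, red || (s != set0) & rel s t].

Definition supp i j c := forall s t, c s t != 0 ->
  [/\ cell s t, #|s|%:Z - 1 = i & #|t|%:Z - 1 = j].

(** The conditions of [Zpred] and [Bpred], for matrices over two complexes. The truncation [red]
    concerns the left side only: for [sub_rel], a nonempty first simplex forces a nonempty second
    one. *)
Definition cyc i j c := [/\ supp i j c, ract c (bd K2 true) = 0 &
  exists y, supp (i - 1) (j - 1) y /\ lact (bd K1 red) c = ract y (bd K2 true)].

Definition bnd i j c := exists y w, [/\ supp i (j - 1) y, supp (i + 1) j w,
  ract w (bd K2 true) = 0 & c = ract y (bd K2 true) + lact (bd K1 red) w].

Lemma suppB i j c d : supp i j c -> supp i j d -> supp i j (c - d).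
Proof.
move=> hc hd s t; rewrite !fctE; have [->|/hc//] := eqVneq (c s t) 0.
by rewrite sub0r oppr_eq0 => /hd.
Qed.

Lemma suppD i j c d : supp i j c -> supp i j d -> supp i j (c + d).
Proof.
move=> hc hd s t; rewrite !fctE; have [->|/hc//] := eqVneq (c s t) 0.
by rewrite add0r => /hd.
Qed.

Lemma cycB i j c d : cyc i j c -> cyc i j d -> cyc i j (c - d).
Proof.
case=> s1 d1 [y1 [u1 e1]] [s2 d2 [y2 [u2 e2]]]; split; first exact: suppB.
  by rewrite ractB d1 d2 subrr.
by exists (y1 - y2); split; [exact: suppB | rewrite lactB ractB e1 e2].
Qed.

Lemma bndB i j c d : bnd i j c -> bnd i j d -> bnd i j (c - d).
Proof.
case=> y1 [w1 [s1 u1 d1 ->]] [y2 [w2 [s2 u2 d2 ->]]].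
exists (y1 - y2), (w1 - w2); split; [exact: suppB | exact: suppB | |].
  by rewrite ractB d1 d2 subrr.
by rewrite ractB lactB addrACA opprD.
Qed.

Definition E2 i j := SubQuot (@cycB i j) (@bndB i j).

End OneDoubleComplex.

(** * Chain maps and homotopies acting on either side *)

Section Functoriality.
Variable red : bool.

Section Left.
Variables (V1 V1' V2 : finType) (K1 : {set {set V1}}) (K1' : {set {set V1'}}).
Variables (K2 : {set {set V2}}) (rel : {set V1} -> {set V2} -> Prop).
Variables (rel' : {set V1'} -> {set V2} -> Prop) (Phi : {set V1'} -> {set V1} -> Prop).
Hypothesis Phirel : forall s' s t,
  s' \in K1' -> s \in K1 -> t \in K2 -> Phi s' s -> rel s t -> rel' s' t.

(** The shift [n] is 0 for chain maps and 1 for homotopies. *)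
Lemma lact_supp n (f : {set V1'} -> {set V1} -> int) c i j :
  (forall (s' : {set V1'}) (s : {set V1}), f s' s != 0 -> s \in K1 ->
     [/\ s' \in K1', #|s'| = (#|s| + n)%N & Phi s' s]) ->
  supp K1 K2 red rel i j c -> supp K1' K2 red rel' (i + n%:Z) j (lact f c).
Proof.
move=> fP hc s' t /lact_neq0[s [/hc[[sK tK rs rst] di dj]]].
move=> /fP/(_ sK)[s'K cs p]; split=> //; last by lia.
split=> //; last exact: Phirel p rst.
case/orP: rs => [-> //|nz]; rewrite -card_gt0 cs addn_gt0 card_gt0 nz; exact: orbT.
Qed.

Lemma lact_mor f i j : chain_map K1 K1' Phi f ->
  qmor (E2 K1 K2 red rel i j) (E2 K1' K2 red rel' i j) (lact f).
Proof.
move=> cf.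
have S a b c : supp K1 K2 red rel a b c -> supp K1' K2 red rel' a b (lact f c).
  move=> hc; rewrite -[a]addr0; apply: (lact_supp (n := 0)) hc => s' s /(cmP cf)[] *.
  by rewrite addn0.
have fbd c : lact (bd K1' red) (lact f c) = lact f (lact (bd K1 red) c).
  by rewrite !lact_assoc (chain_map_bd red cf).
split; first by move=> x y; rewrite lactB.
  move=> c [sc dc [y [sy ey]]]; split; first exact: S.
    by rewrite -lract dc lact0.
  by exists (lact f y); split; [exact: S | rewrite fbd ey lract].
move=> c [y [w [sy sw dw ->]]]; exists (lact f y), (lact f w); split; try exact: S.
  by rewrite -lract dw lact0.
by rewrite lactD fbd lract.
Qed.

(** The difference is d(h c) + h(d c), and d c = delta y turns the last term into delta(h y). *)
Lemma lact_htpy f g i j c : chain_map K1 K1' Phi f -> chain_map K1 K1' Phi g ->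
  chain_htpy K1 K1' Phi f g -> cyc K1 K2 red rel i j c ->
  bnd K1' K2 red rel' i j (lact f c - lact g c).
Proof.
move=> cf cg /(chain_htpy_bd red cf cg)[h [hP hE]] [sc dc [y [sy ey]]].
have S a b d : supp K1 K2 red rel a b d -> supp K1' K2 red rel' (a + 1) b (lact h d).
  apply: (lact_supp (n := 1)) => s' s /hP[_ ? c1 [? _]] _.
  by rewrite addn1.
exists (lact h y), (lact h c); split.
- by rewrite -[i](subrK 1); exact: S.
- exact: S.
- by rewrite -lract dc lact0.
- by rewrite -lactBm hE lactDm -!lact_assoc ey lract addrC.
Qed.

End Left.

Section Right.
Variables (V1 V2 V2' : finType) (K1 : {set {set V1}}) (K2 : {set {set V2}}).
Variables (K2' : {set {set V2'}}) (rel : {set V1} -> {set V2} -> Prop).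
Variables (rel' : {set V1} -> {set V2'} -> Prop) (Phi : {set V2} -> {set V2'} -> Prop).
Hypothesis Phirel : forall s t t', s \in K1 -> t \in K2 -> t' \in K2' ->
  Phi t t' -> rel s t -> rel' s t'.

Lemma ract_supp n (q : {set V2} -> {set V2'} -> int) c i j :
  (forall (t : {set V2}) (t' : {set V2'}), q t t' != 0 ->
     [/\ t' \in K2', #|t| = (#|t'| + n)%N & Phi t t']) ->
  supp K1 K2 red rel i j c -> supp K1 K2' red rel' i (j - n%:Z) (ract c q).
Proof.
move=> qP hc s t' /ract_neq0[t [/hc[[sK tK rs rst] di dj]]].
move=> /qP[t'K ct p]; split=> //; last by lia.
by split=> //; exact: Phirel p rst.
Qed.

Lemma ract_mor q i j : chain_map K2' K2 Phi q ->
  qmor (E2 K1 K2 red rel i j) (E2 K1 K2' red rel' i j) (fun c => ract c q).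
Proof.
move=> cq.
have S a b c : supp K1 K2 red rel a b c -> supp K1 K2' red rel' a b (ract c q).
  move=> hc; rewrite -[b]subr0; apply: (ract_supp (n := 0)) hc => t t' /(cmP cq)[] *.
  by rewrite addn0.
have qbd c : ract (ract c q) (bd K2' true) = ract (ract c (bd K2 true)) q.
  by rewrite !ract_assoc (chain_map_bd true cq).
split; first by move=> x y; rewrite ractB.
  move=> c [sc dc [y [sy ey]]]; split; first exact: S.
    by rewrite qbd dc ract0.
  by exists (ract y q); split; [exact: S | rewrite lract ey qbd].
move=> c [y [w [sy sw dw ->]]]; exists (ract y q), (ract w q); split; try exact: S.
  by rewrite qbd dw ract0.
by rewrite ractD qbd lract.
Qed.

(** Since delta c = 0, one half of the homotopy formula vanishes and the difference is the
    coboundary of [ract c h]. *)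
Lemma ract_htpy q p i j c : chain_map K2' K2 Phi q -> chain_map K2' K2 Phi p ->
  chain_htpy K2' K2 Phi q p -> cyc K1 K2 red rel i j c ->
  bnd K1 K2' red rel' i j (ract c q - ract c p).
Proof.
move=> cq cp /(chain_htpy_bd true cq cp)[h [hP hE]] [sc dc _].
have S a b d : supp K1 K2 red rel a b d -> supp K1 K2' red rel' a (b - 1) (ract d h).
  apply: (ract_supp (n := 1)) => s' s /hP[? _ c1 [? _]].
  by rewrite addn1.
exists (ract c h), 0; split; first exact: S.
- by move=> s t; rewrite eqxx.
- by rewrite ract0.
- by rewrite -ractBm hE ractDm -!ract_assoc dc ract0 add0r lact0 addr0.
Qed.

End Right.

End Functoriality.

(** * Enlarging the relation between the two simplices *)

Section Inclusion.
Variables (V1 V2 : finType) (K1 : {set {set V1}}) (K2 : {set {set V2}}) (red : bool).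
Variables (rel rel' : {set V1} -> {set V2} -> Prop).
Hypotheses (cK1 : is_complex K1) (cK2 : is_complex K2).
Hypothesis rel_sub : forall s t, s \in K1 -> t \in K2 -> rel s t -> rel' s t.
Hypothesis relU : forall (s : {set V1}) (t t' : {set V2}), s \in K1 -> t' \in K2 -> t \subset t' -> rel s t -> rel s t'.
Hypothesis relD : forall (s s' : {set V1}) (t : {set V2}), s \in K1 -> t \in K2 -> s' \subset s -> rel s t -> rel s' t.
Hypothesis relU' : forall (s : {set V1}) (t t' : {set V2}), s \in K1 -> t' \in K2 -> t \subset t' -> rel' s t -> rel' s t'.
Hypothesis relD' : forall (s s' : {set V1}) (t : {set V2}), s \in K1 -> t \in K2 -> s' \subset s -> rel' s t -> rel' s' t.

(* The cells of the quotient column over s can be paired off by toggling a vertex b. *)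
Hypothesis toggle : forall s, s \in K1 -> (exists2 t, t \in K2 & rel' s t /\ ~ rel s t) ->
  exists b, forall t,
    (t \in K2 -> rel' s t -> ~ rel s t ->
       [/\ b |: t \in K2, rel' s (b |: t) & ~ rel s (b |: t)]) /\
    (b |: t \in K2 -> rel' s (b |: t) -> ~ rel s (b |: t) -> rel' s t /\ ~ rel s t).

Lemma supp_ract_bd rl i j c :
  (forall (s : {set V1}) (t t' : {set V2}), s \in K1 -> t' \in K2 -> t \subset t' -> rl s t -> rl s t') ->
  supp K1 K2 red rl i j c -> supp K1 K2 red rl i (j + 1) (ract c (bd K2 true)).
Proof.
move=> rlU hc s t /ract_neq0[t' [/hc[[h1 h2 h3 h4] h5 h6]]].
rewrite /bd /= andbT; case: ifP => [tK /inc_card[ts ct]|_]; last by rewrite eqxx.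
split; [split=> // | done | lia]; exact: rlU ts h4.
Qed.

Lemma supp_lact_bd rl i j c :
  (forall (s s' : {set V1}) (t : {set V2}), s \in K1 -> t \in K2 -> s' \subset s -> rl s t -> rl s' t) ->
  supp K1 K2 red rl i j c -> supp K1 K2 red rl (i - 1) j (lact (bd K1 red) c).
Proof.
move=> rlD hc s t /lact_neq0[s' [/hc[[h1 h2 h3 h4] h5 h6]]].
rewrite /bd /=; case: ifP => [/andP[sK rs] /inc_card[ss cs]|_]; last by rewrite eqxx.
split; [split=> // | lia | done]; last exact: rlD ss h4.
by case: cK1 => _; apply; first exact: h1.
Qed.

Lemma supp_sub i j c : supp K1 K2 red rel i j c -> supp K1 K2 red rel' i j c.
Proof.
by move=> hc s t /hc[[? ? ? h] ? ?]; split=> //; split=> //; exact: rel_sub h.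
Qed.

Lemma bd_bd : mulz (bd K2 true) (bd K2 true) = 0.
Proof.
apply/funext=> s; apply/funext=> t.
have [tK|/negbTE tK] := boolP (t \in K2); last first.
  by rewrite mulzE big1 // => u _; rewrite {2}/bd tK mulr0.
transitivity (mulz (@inc V2) (@inc V2) s t); last by rewrite inc_inc0.
apply: eq_mulz => // u; rewrite /bd /= ?andbT; last by rewrite tK.
rewrite tK => /inc_card[ut _]; by case: cK2 => _ /(_ _ _ tK ut) ->.
Qed.

Lemma ract_bd_bd c : ract (ract c (bd K2 true)) (bd K2 true) = 0 :> ({set V1} -> {set V2} -> G).
Proof. by rewrite ract_assoc bd_bd ract0m. Qed.

(** The columns of the quotient of [rel'] by [rel] are contracted by removing the vertex [b]. A
    chain that is a cycle in the quotient is therefore a coboundary there, and subtracting this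
    coboundary pushes the chain into [rel]. *)
Lemma push_into i j c : supp K1 K2 red rel' i j c ->
  supp K1 K2 red rel i (j + 1) (ract c (bd K2 true)) ->
  exists2 y, supp K1 K2 red rel' i (j - 1) y &
    supp K1 K2 red rel i j (c - ract y (bd K2 true)).
Proof.
move=> hc hdc.
pose Q (s : {set V1}) (t : {set V2}) := t \in K2 /\ (rel' s t /\ ~ rel s t).
(* The toggled vertex of each column, or [None] when the quotient column is empty. *)
have [bb hbb] : exists bb : {set V1} -> option V2, forall s, s \in K1 ->
    match bb s with
    | None => forall t, ~ Q s t
    | Some b => forall t, (Q s t -> Q s (b |: t)) /\ (Q s (b |: t) -> Q s t)
    end.
  suff /choice[bb hbb] : forall s, exists o : option V2, s \in K1 ->
      match o with
      | None => forall t, ~ Q s t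
      | Some b => forall t, (Q s t -> Q s (b |: t)) /\ (Q s (b |: t) -> Q s t)
      end by exists bb.
  move=> s; have [sK|_] := boolP (s \in K1); last by exists None.
  have [[t [tK ht]]|nQ] := pselect (exists t, Q s t); last first.
    by exists None => _ t qt; apply: nQ; exists t.
  have [|b hb] := toggle sK; first by exists t.
  exists (Some b) => _ u; have [h1 h2] := hb u; split.
    by move=> [uK [p1 p2]]; have [] := h1 uK p1 p2.
  move=> [uK [p1 p2]]; have [p3 p4] := h2 uK p1 p2; split=> //.
  by case: cK2 => _; apply; first exact: uK; rewrite subsetUr.
(* [cQ] is the image of [c] in the quotient and [y] its contraction, with the value of [cQ] at
   [b |: t] up to sign. *)
pose cQ s t := if `[< Q s t >] then c s t else 0.
pose y s t := if bb s is Some b then ract cQ (cone b) s t else 0.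
have suppy : supp K1 K2 red rel' i (j - 1) y.
  move=> s t; rewrite /y; case e: (bb s) => [b|]; last by rewrite eqxx.
  case/ract_neq0=> t' []; rewrite /cQ; case: asboolP => [q|_]; last by rewrite eqxx.
  move=> /hc[[h1 h2 h3 h4] h5 h6] /cone_neq0[bt et]; have := hbb _ h1; rewrite e => /(_ t)[_].
  rewrite -et => /(_ q)[tK [rt _]]; split=> //; move: h6; rewrite et cardsU1 bt; lia.
exists y => // s t nz.
have hcy : supp K1 K2 red rel' i j (c - ract y (bd K2 true)).
  apply: suppB => //; rewrite -[j](subrK 1); exact: supp_ract_bd.
have [[h1 h2 h3 h4] h5 h6] := hcy _ _ nz; split=> //; split=> //.
apply: contrapT => nrel; have q : Q s t by [].
move/eqP: nz; apply; have := hbb _ h1; rewrite !fctE ractE /y.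
case e: (bb s) => [b|] hb; last by case: (hb t).
(* [rel] is closed upwards in the second simplex, so cells of [rel] contribute nothing to the
   coboundary at a cell of the quotient. *)
have dcQ t' : Q s t' -> ract cQ (bd K2 true) s t' = 0.
  move=> [t'K [rt' nrt']]; transitivity (ract c (bd K2 true) s t'); last first.
    by apply/eqP/negPn/negP => /hdc[[_ _ _ /nrt']].
  rewrite !ractE; apply: eq_bigr => u _; rewrite /cQ; case: asboolP => // nQ.
  have [->//|/hc[[_ uK _ ru] _ _]] := eqVneq (c s u) 0.
  have [->|] := eqVneq (bd K2 true u t') 0; first by rewrite !mulr0z.
  rewrite /bd t'K /= => /inc_card[ut' _]; case: nQ; split=> //; split=> // rel_su.
  by apply: nrt'; exact: relU ut' rel_su.
have -> : \sum_x ract cQ (cone b) s x *~ bd K2 true x t = ract cQ (mulz (cone b) (@inc _)) s t.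
  rewrite -ract_assoc [RHS]ractE; apply: eq_bigr => x _; congr (_ *~ _).
  by rewrite /bd h2.
(* The identity is split by [inc_cone]; one summand is delta y, the other has to vanish at [t]. *)
have -> : c s t = ract cQ (fun u v => mulz (cone b) (@inc _) u v + mulz (@inc _) (cone b) u v) s t.
  rewrite ractE (bigD1 t) //= big1 ?addr0; first by rewrite addrC inc_cone eqxx /cQ asboolT.
  by move=> u /negbTE nu; rewrite addrC inc_cone nu mulr0z.
rewrite ractE [X in _ - X]ractE -sumrB.
under eq_bigr => u _ do rewrite -mulrzBr addrC addKr.
(* If [b] is in [t], [cone b] has a zero column there. Otherwise only [b |: t] contributes, a
   quotient cell where the coboundary of [cQ] is zero. *)
have [bt|bt] := boolP (b \in t).
  rewrite big1 // => u _; suff -> : mulz (@inc _) (cone b) u t = 0 by rewrite mulr0z.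
  rewrite mulzE big1 // => v _; rewrite /cone /face bt /=; exact: mulr0.
have -> : \sum_u cQ s u *~ mulz (@inc _) (cone b) u t = ract (ract cQ (@inc _)) (cone b) s t.
  by rewrite ract_assoc.
rewrite ractE big1 // => v _.
have [->|/cone_neq0[_ ev]] := eqVneq (cone b v t) 0; first by rewrite mulr0z.
have qv : Q s v by rewrite ev; apply: (hb t).1.
suff -> : ract cQ (@inc _) s v = 0 by rewrite mul0rz.
rewrite -(dcQ v qv) !ractE; apply: eq_bigr => u _.
by case: qv => vK _; rewrite /bd vK.
Qed.

(** Applied to the chain and to its auxiliary witnesses in turn, [push_into] moves a whole cycle or
    boundary certificate from [rel'] into [rel]. *)
Lemma inclusion_qiso i j : qiso (E2 K1 K2 red rel i j) (E2 K1 K2 red rel' i j) id.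
Proof.
split=> //.
- move=> c [sc dc [y [sy ey]]]; split=> //; first exact: supp_sub.
  by exists y; split=> //; exact: supp_sub.
- by move=> c [y [w [sy sw dw ->]]]; exists y, w; split=> //; exact: supp_sub.
- move=> c [sc dc _] [y [w [sy sw dw ec]]].
  (* Replacing [w] by [w1] changes d w by d(delta u) = delta(d u), which [y1] absorbs. *)
  have [|u su sw1] := push_into sw; first by rewrite dw => s t; rewrite eqxx.
  set w1 := w - _ in sw1.
  pose y1 := y + lact (bd K1 red) u.
  have ec1 : c = ract y1 (bd K2 true) + lact (bd K1 red) w1.
    rewrite ec /y1 /w1 ractD lactB -lract -addrA; congr (_ + _).
    by rewrite addrC subrK.
  have sy1 : supp K1 K2 red rel' i (j - 1) y1.
    by apply: suppD => //; rewrite -[i](addrK 1); exact: supp_lact_bd.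
  (* Now the coboundary of [y1] lies in [rel]; subtracting a coboundary from [y1] does not alter
     it. *)
  have [|u' su' sy2] := push_into sy1.
    rewrite subrK; have -> : ract y1 (bd K2 true) = c - lact (bd K1 red) w1.
      by rewrite ec1 addrK.
    apply: suppB => //; rewrite -[i](addrK 1); exact: supp_lact_bd.
  exists (y1 - ract u' (bd K2 true)), w1; split=> //.
    by rewrite /w1 ractB dw ract_bd_bd subrr.
  by rewrite ractB ract_bd_bd subr0.
move=> c [sc dc [y [sy ey]]].
have [|u su sc1] := push_into sc; first by rewrite dc => s t; rewrite eqxx.
exists (c - ract u (bd K2 true)); last first.
  exists u, 0; split=> //; [by move=> s t; rewrite eqxx | by rewrite ract0 | ].
  by rewrite lact0 addr0 opprB addrC subrK.
split=> //; first by rewrite ractB dc ract_bd_bd subrr.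
pose y1 := y - lact (bd K1 red) u.
have ey1 : lact (bd K1 red) (c - ract u (bd K2 true)) = ract y1 (bd K2 true).
  by rewrite lactB ey ractB lract.
have sy1 : supp K1 K2 red rel' (i - 1) (j - 1) y1.
  by apply: suppB => //; exact: supp_lact_bd.
have [|u' su' sy2] := push_into sy1.
  by rewrite subrK -ey1; exact: supp_lact_bd.
exists (y1 - ract u' (bd K2 true)); split=> //.
by rewrite ey1 [RHS]ractB ract_bd_bd subr0.
Qed.

End Inclusion.

End DoubleComplexes.

(** * Subdivisions *)

Section Subdivisions.
Import GRing.Theory.
Local Open Scope ring_scope.

Definition sub_rel (V : finType) (s t : {set V}) : Prop := s \subset t.

Definition car_rel (V0 V1 : finType) (car : {set V1} -> {set V0}) (s : {set V0}) (t : {set V1}) : Prop :=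
  s \subset car t.

Record carrier_fun (V0 V1 : finType) (K0 : {set {set V0}}) (K1 : {set {set V1}})
    (car : {set V1} -> {set V0}) : Prop := CarrierFun {
  car_c0 : is_complex K0;
  car_c1 : is_complex K1;
  carK : forall t, t \in K1 -> car t \in K0;
  carS : forall s t : {set V1}, s \subset t -> car s \subset car t;
  car0 : car set0 = set0;
  car_neq0 : forall t, t \in K1 -> t != set0 -> car t != set0 }.

(** The right-hand isomorphism is required for all [A] and [rho]: when subdivisions are composed, it
    is applied again to the relation already pulled back along the first carrier. *)
Record subdivision (V0 V1 : finType) (K0 : {set {set V0}}) (K1 : {set {set V1}})
    (car : {set V1} -> {set V0}) : Prop := Subdivision {
  sub_car : carrier_fun K0 K1 car;
  sub_right : forall (G : zmodType) (V : finType) (A : {set {set V}}) red rho q i j,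
    (forall a (s t : {set V0}), t \in K0 -> s \subset t -> rho a s -> rho a t) ->
    chain_map K1 K0 (car_rel car) q ->
    qiso (E2 G A K0 red rho i j) (E2 G A K1 red (fun a t => rho a (car t)) i j)
         (fun c => ract c q);
  sub_left : forall (G : zmodType) red q i j,
    chain_map K1 K0 (car_rel car) q ->
    qiso (E2 G K1 K1 red (@sub_rel V1) i j) (E2 G K0 K1 red (car_rel car) i j) (lact q) }.


Section Carried.
Variables (V0 V1 : finType) (K0 : {set {set V0}}) (K1 : {set {set V1}}).
Variable car : {set V1} -> {set V0}.
Hypothesis C : carrier_fun K0 K1 car.

Let Phi (s : {set V0}) (t : {set V1}) := s \in K0 /\ s \subset car t.

Lemma Phi_cone t : t \in K1 -> t != set0 ->
  exists v, forall s, Phi s t -> Phi (v |: s) t.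
Proof.
move=> tK /(car_neq0 C tK)/set0Pn[v vt]; exists v => s [sK st].
have h : v |: s \subset car t by rewrite subUset sub1set vt.
by split=> //; case: (car_c0 C) => _; apply; first exact: carK C _ tK.
Qed.

Lemma Phi_mono s (t u : {set V1}) : u \in K1 -> t \subset u -> Phi s t -> Phi s u.
Proof. by move=> _ tu [sK st]; split=> //; apply: subset_trans st (carS C tu). Qed.

Lemma carried_map : exists q, chain_map K1 K0 (car_rel car) q.
Proof.
have [s t []//||||f cf] := @carrier_map V1 V0 K1 K0 Phi (car_c1 C).
- exact: Phi_mono.
- exact: Phi_cone.
- by split; rewrite ?sub0set //; case: (car_c0 C).
by exists f; apply: chain_map_weaken cf _ => s t _ _ [].
Qed.

Lemma carried_htpy f g : chain_map K1 K0 (car_rel car) f -> chain_map K1 K0 (car_rel car) g ->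
  chain_htpy K1 K0 Phi f g.
Proof.
move=> cf cg.
have W h : chain_map K1 K0 (car_rel car) h -> chain_map K1 K0 Phi h.
  by move=> ch; apply: chain_map_weaken ch _ => s t sK _ ?; split.
apply: carrier_htpy (W _ cf) (W _ cg); first exact: car_c1 C.
- by move=> s t [].
- exact: Phi_mono.
- exact: Phi_cone.
Qed.

End Carried.

(** * Elementary subdivisions, in which every simplex is subdivided as a cone *)

Section OneStep.
Variables (V0 V1 : finType) (K0 : {set {set V0}}) (K1 : {set {set V1}}).
Variable car : {set V1} -> {set V0}.
Hypothesis C : carrier_fun K0 K1 car.
Hypothesis star_apex : forall s : {set V0}, s \in K0 -> s != set0 ->
  exists v, forall t, t \in K1 -> car t \subset s -> v |: t \in K1 /\ car (v |: t) \subset s.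
Hypothesis toggle : forall s : {set V1}, s \in K1 ->
  (exists2 t, t \in K1 & car s \subset car t /\ ~ s \subset t) ->
  exists b, forall t,
    (t \in K1 -> car s \subset car t -> ~ s \subset t ->
       [/\ b |: t \in K1, car s \subset car (b |: t) & ~ s \subset b |: t]) /\
    (b |: t \in K1 -> car s \subset car (b |: t) -> ~ s \subset b |: t ->
       car s \subset car t /\ ~ s \subset t).

Let Psi (t : {set V1}) (s : {set V0}) := t \in K1 /\ car t \subset s.
Let Theta0 (s' s : {set V0}) := s' \in K0 /\ s' \subset s.
Let Theta1 (t' t : {set V1}) := t' \in K1 /\ car t' \subset car t.

Lemma subdivision_map : exists p, chain_map K0 K1 Psi p.
Proof.
apply: carrier_map => //; first exact: car_c0 C.
- by move=> t s [].
- by move=> t s s' _ ss' [tK ts]; split=> //; exact: subset_trans ss'.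
- by move=> s sK /(star_apex sK)[v vP]; exists v => t [tK ts]; exact: vP.
- by split; [case: (car_c1 C) | rewrite (car0 C) sub0set].
Qed.

Lemma subdivision_htpy0 q p : chain_map K1 K0 (car_rel car) q -> chain_map K0 K1 Psi p ->
  chain_map K0 K0 Theta0 (mulz q p) /\ 
  chain_htpy K0 K0 Theta0 (mulz q p) (idz (fun s => s \in K0)).
Proof.
move=> cq cp; have c0 := car_c0 C.
have cqp : chain_map K0 K0 Theta0 (mulz q p).
  have c : chain_map K0 K0 (@sub_rel V0) (mulz q p).
    by apply: chain_map_comp cp cq _ => s t s' h [_ h']; exact: subset_trans h h'.
  by apply: chain_map_weaken c _ => s s' ? ?; split.
split=> //; apply: carrier_htpy cqp _ => //.
- by move=> s s' [].
- by move=> s' s t _ st [sK ss]; split=> //; exact: subset_trans ss st.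
- move=> s sK /set0Pn[v vs]; exists v => s' [_ ss].
  have h : v |: s' \subset s by rewrite subUset sub1set vs.
  by split=> //; case: c0 => _; apply; first exact: sK.
- by apply: chain_map_id.
Qed.

(** The composite may move a simplex [t] anywhere inside the subdivision of [car t]; that whole
    subdivision is taken as its carrier, a cone by [star_apex]. *)
Lemma subdivision_htpy1 q p : chain_map K1 K0 (car_rel car) q -> chain_map K0 K1 Psi p ->
  chain_map K1 K1 Theta1 (mulz p q) /\
  chain_htpy K1 K1 Theta1 (mulz p q) (idz (fun s => s \in K1)).
Proof.
move=> cq cp; have c1 := car_c1 C.
have cpq : chain_map K1 K1 Theta1 (mulz p q).
  apply: chain_map_comp cq cp _ => s t s' [h1 h2] h'; split=> //.
  exact: subset_trans h2 h'.
split=> //; apply: carrier_htpy cpq _ => //.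
- by move=> s s' [].
- by move=> s' s t _ /(carS C) st [sK ss]; split=> //; exact: subset_trans ss st.
- move=> t tK nt; have [v vP] := star_apex (carK C tK) (car_neq0 C tK nt).
  by exists v => t' [t'K h]; exact: vP.
- by apply: chain_map_id.
Qed.

Section Coefficients.
Variable G : zmodType.

Lemma one_step_right (V : finType) (A : {set {set V}}) red rho q i j :
  (forall a (s t : {set V0}), t \in K0 -> s \subset t -> rho a s -> rho a t) ->
  chain_map K1 K0 (car_rel car) q ->
  qiso (E2 G A K0 red rho i j) (E2 G A K1 red (fun a t => rho a (car t)) i j)
         (fun c => ract c q).
Proof.
move=> rmono cq; have [p cp] := subdivision_map.
have [cqp hqp] := subdivision_htpy0 cq cp.
have [cpq hpq] := subdivision_htpy1 cq cp.
apply: (@qiso_inverse _ _ _ _ _ (fun c => ract c p)).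
- apply: ract_mor cq => a s t _ _ tK st; apply: rmono st; exact: carK C _ tK.
- by apply: ract_mor cp => a t s _ _ sK [_ ts]; exact: rmono ts.
- move=> c zc.
  have h := @ract_htpy G red _ _ _ A K0 K0 rho rho Theta0 _ _ _ _ _ _ cqp
     (chain_map_id (car_c0 C) _) hqp zc.
  have -> : ract (ract c q) p - c = ract c (mulz q p) - ract c (idz (fun s => s \in K0)).
    rewrite ract_assoc; congr (_ - _); apply/esym/ract_id => a b nz.
    by case: zc => /(_ _ _ nz) [[]].
  apply: h; last by move=> s sK; split.
  by move=> a s t _ _ tK [_ st]; exact: rmono st.
- move=> c zc.
  pose rho' a t := rho a (car t).
  have h := @ract_htpy G red _ _ _ A K1 K1 rho' rho' Theta1 _ _ _ _ _ _ cpq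
     (chain_map_id (car_c1 C) _) hpq zc.
  have -> : ract (ract c p) q - c = ract c (mulz p q) - ract c (idz (fun s => s \in K1)).
    rewrite ract_assoc; congr (_ - _); apply/esym/ract_id => a b nz.
    by case: zc => /(_ _ _ nz) [[]].
  apply: h; last by move=> s sK; split.
  by move=> a s t _ _ tK [_ st]; apply: rmono st; exact: carK C _ tK.
Qed.

(** The subdivision map [p] and its homotopies respect the relation [rel'] on carriers, whereas
    inclusion of simplices may be lost. Hence the detour through [rel'], reached from [sub_rel] by
    [inclusion_qiso]. *)
Lemma one_step_left red q i j : chain_map K1 K0 (car_rel car) q ->
  qiso (E2 G K1 K1 red (@sub_rel V1) i j) (E2 G K0 K1 red (car_rel car) i j) (lact q).
Proof.
move=> cq; pose rel' (s t : {set V1}) : Prop := car s \subset car t.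
have c1 := car_c1 C.
have I : qiso (E2 G K1 K1 red (@sub_rel V1) i j) (E2 G K1 K1 red rel' i j) id.
  apply: inclusion_qiso => //.
  - by move=> s t _ _; exact: (carS C).
  - by move=> s t t' _ _ tt st; exact: subset_trans st tt.
  - by move=> s s' t _ _ ss st; exact: subset_trans ss st.
  - by move=> s t t' _ _ /(carS C) tt st; exact: subset_trans st tt.
  - by move=> s s' t _ _ /(carS C) ss st; exact: subset_trans ss st.
suff J : qiso (E2 G K1 K1 red rel' i j) (E2 G K0 K1 red (car_rel car) i j) (lact q).
  exact: qiso_comp I J.
have [p cp] := subdivision_map.
have [cqp hqp] := subdivision_htpy0 cq cp.
have [cpq hpq] := subdivision_htpy1 cq cp.
apply: (@qiso_inverse _ _ _ _ _ (lact p)).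
- by apply: lact_mor cq => s t u _ _ _ st tu; exact: subset_trans st tu.
- by apply: lact_mor cp => t s u _ _ _ [_ ts] su; exact: subset_trans ts su.
- move=> c zc.
  have h := @lact_htpy G red _ _ _ K1 K1 K1 rel' rel' Theta1 _ _ _ _ _ _ cpq
     (chain_map_id (car_c1 C) _) hpq zc.
  have -> : lact p (lact q c) - c = lact (mulz p q) c - lact (idz (fun s => s \in K1)) c.
    rewrite lact_assoc; congr (_ - _); apply/esym/lact_id => a b nz.
    by case: zc => /(_ _ _ nz) [[]].
  apply: h; last by move=> s sK; split.
  by move=> s s' t _ _ _ [_ st] ss; exact: subset_trans st ss.
- move=> c zc.
  have h := @lact_htpy G red _ _ _ K0 K0 K1 (car_rel car) (car_rel car) Theta0 _ _ _ _ _ _ cqp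
     (chain_map_id (car_c0 C) _) hqp zc.
  have -> : lact q (lact p c) - c = lact (mulz q p) c - lact (idz (fun s => s \in K0)) c.
    rewrite lact_assoc; congr (_ - _); apply/esym/lact_id => a b nz.
    by case: zc => /(_ _ _ nz) [[]].
  apply: h; last by move=> s sK; split.
  by move=> s s' t _ _ _ [_ st] ss; exact: subset_trans st ss.
Qed.

End Coefficients.

Lemma one_step_subdivision : subdivision K0 K1 car.
Proof.
split=> //; first by move=> G V A red rho q i j; exact: one_step_right.
by move=> G red q i j; exact: one_step_left.
Qed.

End OneStep.

(** The composite of carried maps [q1] and [q2] is used first; any other carried map is homotopic to
    it. *)
Lemma subdivision_comp (V0 V1 V2 : finType) (K0 : {set {set V0}}) (K1 : {set {set V1}})
    (K2 : {set {set V2}}) car1 car2 :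
  subdivision K0 K1 car1 -> subdivision K1 K2 car2 -> subdivision K0 K2 (car1 \o car2).
Proof.
move=> [C1 R1 L1] [C2 R2 L2].
have C : carrier_fun K0 K2 (car1 \o car2).
  split=> /=; [exact: car_c0 C1 | exact: car_c1 C2 | | | |].
  - by move=> t /(carK C2)/(carK C1).
  - by move=> s t /(carS C2)/(carS C1).
  - by rewrite (car0 C2) (car0 C1).
  - by move=> t tK /(car_neq0 C2 tK)/(car_neq0 C1 (carK C2 tK)).
have [q1 cq1] := carried_map C1; have [q2 cq2] := carried_map C2.
have cq12 : chain_map K2 K0 (car_rel (car1 \o car2)) (mulz q1 q2).
  apply: chain_map_comp cq2 cq1 _ => s t u st /(carS C1) tu; exact: subset_trans st tu.
split=> //.
- move=> G V A red rho q i j rmono cq.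
  have I1 := R1 G V A red rho q1 i j rmono cq1.
  have rmono2 a (s t : {set V1}) : t \in K1 -> s \subset t -> rho a (car1 s) -> rho a (car1 t).
    by move=> tK /(carS C1); apply: rmono; exact: carK C1 _ tK.
  have I2 := R2 G V A red _ q2 i j rmono2 cq2.
  apply: qiso_eqmod (qiso_comp I1 I2) _ _.
    apply: ract_mor cq => a s t _ _ tK st; apply: rmono st; exact: carK C _ tK.
  move=> c zc /=; rewrite ract_assoc.
  have W f : chain_map K2 K0 (car_rel (car1 \o car2)) f ->
      chain_map K2 K0 (fun s t => s \in K0 /\ s \subset (car1 \o car2) t) f.
    by move=> ch; apply: chain_map_weaken ch _ => s t sK _ ?; split.
  apply: ract_htpy (W _ cq) (W _ cq12) (carried_htpy C cq cq12) zc.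
  by move=> a s t _ _ tK [_ st]; apply: rmono st; exact: carK C _ tK.
- move=> G red q i j cq.
  have I2 := L2 G red q2 i j cq2.
  have I1 : qiso (E2 G K1 K2 red (car_rel car2) i j)
                 (E2 G K0 K2 red (car_rel (car1 \o car2)) i j) (lact q1).
    have A1 := L1 G red q1 i j cq1.
    have B1 := R2 G _ K1 red (@sub_rel V1) q2 i j _ cq2.
    have B0 := R2 G _ K0 red (car_rel car1) q2 i j _ cq2.
    (* In the commuting square from E(K1,K1) to E(K0,K2), three sides are already isomorphisms, so
       the fourth, E(K1,K2) -> E(K0,K2), is one too. *)
    apply: (qiso_cancel_right (B1 _)).
    + by move=> a s t _ st h; exact: subset_trans h st.
    + apply: lact_mor cq1 => s t u _ _ _ st /(carS C1) tu; exact: subset_trans st tu.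
    have -> : lact q1 \o (fun c : {set V1} -> {set V1} -> G => ract c q2) =
              (fun c => ract c q2) \o lact q1 by apply/funext=> c /=; rewrite lract.
    apply: qiso_comp A1 (B0 _).
    by move=> a s t _ /(carS C1) st h; exact: subset_trans h st.
  apply: qiso_eqmod (qiso_comp I2 I1) _ _.
    by apply: lact_mor cq => s t u _ _ _ st /(carS C) tu; exact: subset_trans st tu.
  move=> c zc /=; rewrite lact_assoc.
  have W f : chain_map K2 K0 (car_rel (car1 \o car2)) f ->
      chain_map K2 K0 (fun s t => s \in K0 /\ s \subset (car1 \o car2) t) f.
    by move=> ch; apply: chain_map_weaken ch _ => s t sK _ ?; split.
  apply: lact_htpy (W _ cq) (W _ cq12) (carried_htpy C cq cq12) zc.
  by move=> s t u _ _ _ [_ st] /(carS C) tu; exact: subset_trans st tu.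
Qed.

Lemma subdivision_id (V : finType) (K : {set {set V}}) : is_complex K -> subdivision K K id.
Proof.
move=> cK; apply: one_step_subdivision => //.
- move=> s sK /set0Pn[v vs]; exists v => t tK ts.
  have h : v |: t \subset s by rewrite subUset sub1set vs.
  by split=> //; case: cK => _; apply; first exact: sK.
- by move=> s _ [t _ []].
Qed.

End Subdivisions.

(** * L-homology and stellar subdivisions *)

Section LHomology.
Import GRing.Theory.
Local Open Scope quotient_scope.
Local Open Scope ring_scope.

(** A correspondence between representatives suffices: the chosen functions [f] and [g] are not
    additive, but become so modulo [J] and [I]. *)
Lemma quot_iso (A B : zmodType) (I : zmodClosed A) (J : zmodClosed B) (R : A -> B -> Prop) :
  (forall a1 a2 b1 b2, R a1 b1 -> R a2 b2 -> R (a1 - a2) (b1 - b2)) ->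
  (forall a, exists b, R a b) -> (forall b, exists a, R a b) ->
  (forall a b, R a b -> a \in I <-> b \in J) ->
  zmod_iso (Quotient.quot I) (Quotient.quot J).
Proof.
move=> RB /choice[f fP] /choice[g gP] RIJ.
have RD a1 a2 b1 b2 : R a1 b1 -> R a2 b2 -> R (a1 + a2) (b1 + b2).
  move=> h1 h2; have h0 := RB _ _ _ _ h2 h2; rewrite !subrr in h0.
  have := RB _ _ _ _ h1 (RB _ _ _ _ h0 h2); by rewrite !sub0r !opprK.
exists (fun x => \pi_(Quotient.quot J) (f (repr x))); split.
  move=> x y; transitivity (\pi_(Quotient.quot J) (f (repr x) + f (repr y))); last exact: Quotient.pi_add.
  apply/eqP; rewrite -Quotient.idealrBE.
  apply/(RIJ _ _ (RB _ _ _ _ (fP _) (RD _ _ _ _ (fP _) (fP _)))).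
  rewrite Quotient.idealrBE reprK; apply/eqP; apply: (etrans _ (esym (Quotient.pi_add _ _ _))).
  by rewrite !reprK.
exists (fun y => \pi_(Quotient.quot I) (g (repr y))) => [x|y].
  rewrite -[RHS]reprK; apply/eqP; rewrite -Quotient.idealrBE.
  apply/(RIJ _ _ (RB _ _ _ _ (gP _) (fP _))).
  by rewrite Quotient.idealrBE reprK.
rewrite -[RHS]reprK; apply/eqP; rewrite -Quotient.idealrBE.
apply/(RIJ _ _ (RB _ _ _ _ (fP _) (gP _))).
by rewrite Quotient.idealrBE reprK.
Qed.

(** * From the double complex of the statement to matrices *)

Section Bridge.
Variables (G : zmodType) (V : finType) (K : {set {set V}}) (red : bool).
Hypothesis cK : is_complex K.

Definition curry2 (c : Mod V G) : {set V} -> {set V} -> G := fun s t => c (s, t).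
Definition uncurry2 (c : {set V} -> {set V} -> G) : Mod V G := [ffun x : cellT V => c x.1 x.2].

Lemma uncurry2K c : curry2 (uncurry2 c) = c.
Proof. by apply/funext=> s; apply/funext=> t; rewrite /curry2 ffunE. Qed.

Lemma curry2_inj : injective curry2.
Proof.
move=> c d e; apply/ffunP => -[s t].
by have := congr1 (fun f : {set V} -> {set V} -> G => f s t) e.
Qed.

Lemma curry2B c d : curry2 (c - d) = curry2 c - curry2 d.
Proof. by apply/funext=> s; apply/funext=> t; rewrite /curry2 !fctE !ffunE. Qed.

Lemma curry2D c d : curry2 (c + d) = curry2 c + curry2 d.
Proof. by apply/funext=> s; apply/funext=> t; rewrite /curry2 !fctE !ffunE. Qed.

Lemma curry2_0 : curry2 0 = 0.
Proof. by apply/funext=> s; apply/funext=> t; rewrite /curry2 !ffunE. Qed.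

Lemma inT_supp i j c : inT K red i j c <-> supp K K red (@sub_rel V) i j (curry2 c).
Proof.
split=> [/forallP h s t nz|h].
  have /implyP/(_ nz)/andP[/and3P[/= st tK rs] /eqP[-> ->]] := h (s, t).
  by split=> //; split=> //; case: cK => _; apply; first exact: tK.
apply/forallP => -[s t]; apply/implyP => /h[[sK tK rs st] <- <-].
by rewrite /valid /bideg /= tK rs eqxx !andbT.
Qed.

Lemma sgnGE n (g : G) : sgnG n g = g *~ ((-1) ^+ n).
Proof. by rewrite /sgnG -signr_odd; case: odd; rewrite ?expr1 ?expr0 ?mulrN1z ?mulr1z. Qed.

(** [delta] is set to 0 on invalid cells. The matrix product agrees there because either [bd] or, by
    its support condition, [c] vanishes. *)
Lemma curry2_delta i j c : inT K red i j c ->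
  curry2 (delta K red c) = ract (curry2 c) (bd K true).
Proof.
move=> /inT_supp hc; apply/funext=> s; apply/funext=> t; rewrite /curry2 ffunE /=.
rewrite ractE; have [tK|tK] := boolP (t \in K); last first.
  rewrite /valid /= (negbTE tK) andbF big1 // => u _.
  by rewrite /bd (negbTE tK) mulr0z.
have -> : \sum_u c (s, u) *~ bd K true u t =
   \sum_(v in t) c (s, t :\ v) *~ sgnz v (t :\ v).
  under eq_bigr => u _.
    rewrite /bd tK /= /inc mulrz_sumr; over.
  rewrite exchange_big [RHS]big_mkcond /=; apply: eq_bigr => v _.
  case: ifP => vt.
    rewrite (bigD1 (t :\ v)) //= big1 ?addr0.
      by rewrite /face !inE eqxx /= setD1K // eqxx.
    move=> u nu; rewrite /face; case: ifP => [/andP[vu /eqP e]|]; last by rewrite mulr0z.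
    by rewrite e setU1K ?eqxx in nu.
  rewrite big1 // => u _; rewrite /face; case: ifP => [/andP[vu /eqP e]|]; last by rewrite mulr0z.
  by rewrite e !inE eqxx in vt.
case: ifP => [_|nv]; first apply: eq_bigr => v vt.
  rewrite sgnGE /sgnz; congr (_ *~ (_ ^+ _)); apply: eq_card => u; rewrite !inE.
  by case: (eqVneq u v) => [->|//]; rewrite /vless ltnn !andbF.
rewrite big1 // => v vt.
have [->|/hc[[_ _ rs st] _ _]] := eqVneq (c (s, t :\ v)) 0; first by rewrite mul0rz.
by move: nv; rewrite /valid /= tK rs (subset_trans st) ?subD1set.
Qed.

Lemma curry2_dd i j c : inT K red i j c ->
  curry2 (dd K red c) = lact (bd K red) (curry2 c).
Proof.
move=> /inT_supp hc; apply/funext=> s; apply/funext=> t; rewrite /curry2 ffunE /=.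
rewrite lactE.
have [nv|rs] := boolP (~~ (red || (s != set0))).
  rewrite /valid /= (negbTE nv) !andbF big1 // => u _.
  by rewrite /bd (negbTE nv) andbF mulr0z.
have -> : \sum_u c (u, t) *~ bd K red s u =
   \sum_(v in ~: s) c (v |: s, t) *~ sgnz v s.
  transitivity (\sum_u c (u, t) *~ inc s u).
    apply: eq_bigr => u _; rewrite /bd (negbNE rs) andbT; case: ifP => // uK.
    by have [->|/hc[[]]] := eqVneq (c (u, t)) 0; rewrite ?mul0rz // uK.
  under eq_bigr => u _ do rewrite /inc mulrz_sumr.
  rewrite exchange_big [RHS]big_mkcond /=; apply: eq_bigr => v _.
  rewrite inE; case: ifP => vs.
    rewrite (bigD1 (v |: s)) //= big1 ?addr0; first by rewrite /face vs eqxx.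
    by move=> u /negbTE nu; rewrite /face nu andbF mulr0z.
  by rewrite big1 // => u _; rewrite /face vs mulr0z.
case: ifP => [_|nv]; first by apply: eq_bigr => v vt; rewrite sgnGE.
rewrite big1 // => v vt.
have [->|/hc[[_ tK _ st] _ _]] := eqVneq (c (v |: s, t)) 0; first by rewrite mul0rz.
by move: nv; rewrite /valid /= tK (negbNE rs) (subset_trans _ st) ?subsetUr.
Qed.

Lemma inT_uncurry2 i j c : supp K K red (@sub_rel V) i j c -> inT K red i j (uncurry2 c).
Proof. by move=> h; apply/inT_supp; rewrite uncurry2K. Qed.

Local Notation E := (E2 G K K red (@sub_rel V)).

Lemma Zpred_cyc i j c : (c \in Zpred K red i j) <-> zq (E i j) (curry2 c).
Proof.
rewrite inE /=; split.
  move=> /and3P[h /eqP d /asboolP[y [hy e]]]; split; first exact/inT_supp.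
    by rewrite -(curry2_delta h) d curry2_0.
  exists (curry2 y); split; first exact/inT_supp.
  by rewrite -(curry2_dd h) -(curry2_delta hy) e.
move=> [/inT_supp h d [y [hy e]]]; rewrite h /=; apply/andP; split.
  by apply/eqP/curry2_inj; rewrite (curry2_delta h) d curry2_0.
have hy' := inT_uncurry2 hy.
apply/asboolP; exists (uncurry2 y); split=> //.
by apply: curry2_inj; rewrite (curry2_dd h) (curry2_delta hy') uncurry2K.
Qed.

Lemma Bpred_bnd i j (z : Zt G K red i j) :
  (z \in @Bpred V G K red i j) <-> bq (E i j) (curry2 (val z)).
Proof.
rewrite inE /=; split.
  move=> /asboolP[y [w [hy hw d e]]]; exists (curry2 y), (curry2 w).
  split; [exact/inT_supp | exact/inT_supp | |].
    by rewrite -(curry2_delta hw) d curry2_0.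
  by rewrite e curry2D (curry2_delta hy) (curry2_dd hw).
move=> [y [w [hy hw d e]]]; apply/asboolP; exists (uncurry2 y), (uncurry2 w).
have hy' := inT_uncurry2 hy; have hw' := inT_uncurry2 hw; split=> //.
  by apply: curry2_inj; rewrite (curry2_delta hw') uncurry2K d curry2_0.
by apply: curry2_inj; rewrite curry2D (curry2_delta hy') (curry2_dd hw') !uncurry2K.
Qed.

End Bridge.

(** Two representatives correspond when their images in [T] differ by a boundary. *)
Lemma LH_iso_zigzag (G : zmodType) (V V' : finType) (K : {set {set V}}) (K' : {set {set V'}})
    red i j (M : zmodType) (T : subquot M) f g :
  is_complex K -> is_complex K' ->
  qiso (E2 G K K red (@sub_rel V) i j) T f ->
  qiso (E2 G K' K' red (@sub_rel V') i j) T g ->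
  zmod_iso (LH G K red i j) (LH G K' red i j).
Proof.
move=> cK cK' qf qg.
have zZ (z : Zt G K red i j) : zq (E2 G K K red (@sub_rel V) i j) (curry2 (val z)).
  by apply/(Zpred_cyc _ cK); exact: valP.
have zZ' (z : Zt G K' red i j) : zq (E2 G K' K' red (@sub_rel V') i j) (curry2 (val z)).
  by apply/(Zpred_cyc _ cK'); exact: valP.
apply: (@quot_iso _ _ _ _ (fun (z : Zt G K red i j) (w : Zt G K' red i j) =>
  bq T (f (curry2 (val z)) - g (curry2 (val w))))).
- move=> a1 a2 b1 b2 h1 h2; have := bqB h1 h2.
  by rewrite !(raddfB val) !curry2B (qisoB qf) (qisoB qg) !opprD addrACA.
- move=> a; have [x zx bx] := qiso_surj qg (qisoz qf (zZ a)).
  have px : uncurry2 x \in Zpred K' red i j by apply/(Zpred_cyc _ cK'); rewrite uncurry2K.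
  by exists (Sub (uncurry2 x) px : Zt G K' red i j); rewrite SubK uncurry2K.
- move=> b; have [x zx bx] := qiso_surj qf (qisoz qg (zZ' b)).
  have px : uncurry2 x \in Zpred K red i j by apply/(Zpred_cyc _ cK); rewrite uncurry2K.
  by exists (Sub (uncurry2 x) px : Zt G K red i j); rewrite SubK uncurry2K; exact: bq_sym.
- move=> a b h; split.
  + move=> /(Bpred_bnd cK) ba; apply/(Bpred_bnd cK').
    by apply: (qiso_inj qg) => //; apply: bq_eq (bq_sym h) (qisob qf ba).
  + move=> /(Bpred_bnd cK') bb; apply/(Bpred_bnd cK).
    by apply: (qiso_inj qf) => //; apply: bq_eq h (qisob qg bb).
Qed.

Lemma subdivision_LH (G : zmodType) (V V' : finType) (K : {set {set V}}) (K' : {set {set V'}})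
    car red i j : subdivision K K' car -> zmod_iso (LH G K red i j) (LH G K' red i j).
Proof.
move=> S; have [q cq] := carried_map (sub_car S).
apply: (LH_iso_zigzag (car_c0 (sub_car S)) (car_c1 (sub_car S))).
  apply: (@sub_right _ _ _ _ _ S G _ K red (@sub_rel V) q i j _ cq).
  by move=> a s t _ st h; exact: subset_trans h st.
exact: (sub_left S G red i j cq).
Qed.

End LHomology.

(** * Stellar subdivisions as elementary subdivisions *)

Section Stellar.
Variables (V : finType) (K : {set {set V}}) (sg : {set V}).
Hypothesis cK : is_complex K.

Definition old_part (t : {set option V}) : {set V} := [set x | Some x \in t].

(** The new vertex lies in the interior of [sg], so its carrier is [sg]. *)
Definition stellar_car (t : {set option V}) : {set V} :=
  old_part t :|: (if None \in t then sg else set0).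

Lemma old_partS (s t : {set option V}) : s \subset t -> old_part s \subset old_part t.
Proof. by move=> /subsetP st; apply/subsetP=> x; rewrite !inE; exact: st. Qed.

Lemma stellar_carS (s t : {set option V}) : s \subset t -> stellar_car s \subset stellar_car t.
Proof.
move=> st; apply: setUSS; first exact: old_partS.
by case: ifP => [/(subsetP st) -> //|_]; rewrite sub0set.
Qed.

Lemma stellar_car0 : stellar_car set0 = set0.
Proof. by apply/setP=> x; rewrite !inE /= ?inE. Qed.

Lemma old_part_imset (s : {set V}) : old_part [set Some x | x in s] = s.
Proof. by apply/setP=> x; rewrite inE mem_imset // => a b []. Qed.

Lemma imset_old_part (t : {set option V}) : None \notin t -> [set Some x | x in old_part t] = t.
Proof.
move=> nt; apply/setP=> -[x|]; first by rewrite mem_imset ?inE // => a b [].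
by rewrite (negbTE nt); apply/negP => /imsetP[].
Qed.

Lemma None_imset (s : {set V}) : None \notin [set Some x | x in s].
Proof. by apply/negP => /imsetP[]. Qed.

Lemma mem_stellar0 (t : {set option V}) : sg = set0 ->
  (t \in stellar K sg) = (None \notin t) && (stellar_car t \in K).
Proof.
move=> s0; rewrite /stellar s0 cards0 /=; apply/imsetP/andP => [[u uK ->]|[nt tK]].
  by rewrite None_imset /stellar_car (negbTE (None_imset u)) setU0 old_part_imset.
exists (old_part t); last by rewrite imset_old_part.
by move: tK; rewrite /stellar_car (negbTE nt) setU0.
Qed.

(** One description covers the renaming of a vertex and the subdivision of a larger simplex: when
    [sg] is a vertex, the last condition says that its old copy is gone. For empty [sg] that
    condition would exclude everything, hence the separate [mem_stellar0]. *)
Lemma mem_stellar (t : {set option V}) : sg != set0 ->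
  (t \in stellar K sg) = (stellar_car t \in K) && ~~ (sg \subset old_part t).
Proof.
have Kd := cK.2; move=> nz; rewrite /stellar cards_eq0 (negbTE nz).
case: ifP => [/cards1P[x ex]|_].
  apply/imsetP/andP => [[u uK ->]|[tK nt]].
    have oE : old_part [set (if x0 \in sg then None else Some x0) | x0 in u] = u :\: sg.
      apply/setP=> y; rewrite !inE; apply/imsetP/andP => [[z zu]|[ys yu]].
        by case: ifP => // zs [->]; rewrite zs.
      by exists y; rewrite // (negbTE ys).
    have nE : None \in [set (if x0 \in sg then None else Some x0) | x0 in u] = (x \in u).
      apply/imsetP/idP => [[z zu]|xu]; last by exists x; rewrite // ex inE eqxx.
      by rewrite ex inE; case: eqP => [<-|].
    rewrite /stellar_car oE nE ex; split; last by rewrite sub1set !inE eqxx.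
    case: ifP => xu; first by rewrite setUC setD1K.
    by rewrite setU0; apply: Kd uK _; exact: subsetDl.
  exists (stellar_car t) => //; rewrite ex sub1set inE in nt.
  apply/setP=> -[y|]; apply/idP/imsetP.
  - move=> yt; exists y; first by rewrite !inE yt.
    by rewrite ex inE; case: eqP => // e; rewrite -e yt in nt.
  - case=> z; rewrite !inE => /orP[zt|]; first by case: ifP => // _ [->].
    by case: ifP => _; rewrite ?inE // => ->.
  - by move=> Nt; exists x; rewrite ?ex !inE ?Nt ?ex ?inE ?eqxx ?orbT.
  - case=> z zt; rewrite ex inE; case: (eqVneq z x) => [zx _|//].
    by move: zt; rewrite zx !inE (negbTE nt) /=; case: ifP => //; rewrite inE.
rewrite inE; apply/orP/andP => [[/imsetP[u]|/imset2P[a b]]|[tK nt]].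
- rewrite inE => /andP[uK nu] ->.
  by rewrite /stellar_car (negbTE (None_imset u)) setU0 old_part_imset.
- rewrite !inE => asg /andP[/andP[bK /andP[bsg dis]] na] ->.
  have oE : old_part (None |: [set Some x | x in a :|: b]) = a :|: b.
    by apply/setP=> y; rewrite !inE /= mem_imset ?inE // => ? ? [].
  rewrite /stellar_car oE !inE eqxx /=; split.
    by rewrite setUAC; move/setUidPr: asg => ->.
  apply/negP => /subsetP h; case/eqP: na; apply/eqP; rewrite eqEsubset asg; apply/subsetP => y ys.
  have := h _ ys; rewrite inE => /orP[//|yb].
  by move: dis => /pred0P/(_ y) /=; rewrite ys yb.
case: (boolP (None \in t)) => Nt; last first.
  left; apply/imsetP; exists (old_part t); last by rewrite imset_old_part.
  by rewrite inE nt andbT; move: tK; rewrite /stellar_car (negbTE Nt) setU0.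
right; move: tK; rewrite /stellar_car Nt => tK.
(* The part inside [sg] is the proper face, the part outside lies in the link. *)
apply/imset2P; exists (old_part t :&: sg) (old_part t :\: sg).
- by rewrite inE subsetIr.
- rewrite !inE; apply/andP; split; last first.
    by apply: contra nt => /eqP <-; exact: subsetIl.
  apply/andP; split; first by apply: Kd tK _; apply/subsetP=> y; rewrite !inE => /andP[_ ->].
  apply/andP; split; last by rewrite disjoint_sym disjoints_subset; apply/subsetP=> y; rewrite !inE => /andP[].
  by apply: Kd tK _; apply/subsetP=> y; rewrite !inE; case: (y \in sg); rewrite ?orbT //= => ->.
- rewrite setID; apply/setP=> -[y|]; rewrite !inE /= ?Nt //.
  by rewrite mem_imset ?inE // => ? ? [].
Qed.

Lemma old_partU1 x (t : {set option V}) : old_part (Some x |: t) = x |: old_part t.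
Proof. by apply/setP=> y; rewrite !inE /= (inj_eq (@Some_inj _)). Qed.

Lemma old_partN (t : {set option V}) : old_part (None |: t) = old_part t.
Proof. by apply/setP=> y; rewrite !inE. Qed.

Lemma stellar_carU1 x (t : {set option V}) :
  stellar_car (Some x |: t) = x |: stellar_car t.
Proof. by rewrite /stellar_car old_partU1 !inE /= setUA. Qed.

Lemma sub_old (s t : {set option V}) :
  (s \subset t) = (old_part s \subset old_part t) && ((None \in s) ==> (None \in t)).
Proof.
apply/idP/andP => [st|[st Nst]].
  by split; [exact: old_partS | apply/implyP; exact: (subsetP st)].
apply/subsetP=> -[x|]; last exact: (implyP Nst).
by have := subsetP st x; rewrite !inE.
Qed.

Lemma stellar_car_neq0 (t : {set option V}) : sg != set0 -> t != set0 -> stellar_car t != set0.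
Proof.
move=> nz /set0Pn[[x|] xt]; apply/set0Pn; first by exists x; rewrite !inE xt.
by have /set0Pn[x xs] := nz; exists x; rewrite !inE xt xs orbT.
Qed.

Lemma stellar_subdivision_neq0 : sg != set0 -> subdivision K (stellar K sg) stellar_car.
Proof.
move=> nz; have Kd := cK.2; have mS t := mem_stellar t nz.
have cS : is_complex (stellar K sg).
  split; first by rewrite mS stellar_car0 cK.1; apply/negP => /subsetP h; have /set0Pn[x /h] := nz; rewrite !inE.
  move=> s t; rewrite !mS => /andP[sK ns] ts; rewrite (Kd _ _ sK (stellar_carS ts)) /=.
  by apply: contra ns => h; exact: subset_trans h (old_partS ts).
have C : carrier_fun K (stellar K sg) stellar_car.
  split=> //; [by move=> t; rewrite mS => /andP[] | exact: stellar_carS | exact: stellar_car0 |].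
  by move=> t _; exact: stellar_car_neq0.
apply: one_step_subdivision => //.
  (* If [s] contains [sg] its subdivision is a cone from the new vertex; otherwise [s] is not
     subdivided and any of its vertices is an apex. *)
  move=> s sK ns; have [sgs|nsgs] := boolP (sg \subset s).
    exists None => t; rewrite !mS => /andP[tK nt] ts.
    have e : stellar_car (None |: t) \subset s.
      rewrite /stellar_car old_partN !inE eqxx /= subUset sgs andbT.
      by apply: subset_trans ts; exact: subsetUl.
    by split=> //; rewrite old_partN nt (Kd _ _ sK e).
  have /set0Pn[x xs] := ns; exists (Some x) => t; rewrite !mS => /andP[tK nt] ts.
  have e : stellar_car (Some x |: t) \subset s by rewrite stellar_carU1 subUset sub1set xs.
  split=> //; rewrite (Kd _ _ sK e) /=; apply: contra nsgs => h.
  apply: subset_trans e; apply: subset_trans h _; exact: subsetUl.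
move=> s; rewrite mS => /andP[sK ns] [t tK [st /negP nst]].
(* Toggle a vertex [b] of [sg] missing from [s]. The cells in question contain the new vertex, so
   [b] does not affect their carriers, and they miss some vertex [y] of [s] in [sg], which differs
   from [b] and stays missing. *)
have /subsetPn[b bsg bs] := ns; exists (Some b) => {tK st nst} u.
have N v : sg \subset stellar_car v -> b |: stellar_car v = stellar_car v.
  by move=> h; apply/setUidPr; rewrite sub1set; exact: (subsetP h).
have key v : v \in stellar K sg -> stellar_car s \subset stellar_car v -> ~ s \subset v ->
   None \in v /\ exists2 y, y \in old_part s & y \notin old_part v /\ y \in sg.
  rewrite mS => /andP[vK nv] sv /negP; rewrite sub_old negb_and => nsv.
  have Nv : None \in v.
    apply/negPn/negP => Nv; move: sv.
    have -> : stellar_car v = old_part v by rewrite /stellar_car (negbTE Nv) setU0.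
    rewrite /stellar_car subUset => /andP[h1 h2]; move: nsv; rewrite h1 /= (negbTE Nv).
    by case Ns: (None \in s) => //; rewrite Ns in h2; rewrite h2 in nv.
  split=> //; move: nsv; rewrite Nv implybT orbF => /subsetPn[y ys yv]; exists y => //.
  split=> //; have : y \in stellar_car v by apply: (subsetP sv); rewrite inE ys.
  by rewrite inE (negbTE yv) Nv.
split.
  move=> uK su nsu; have [Nu [y ys [yu ysg]]] := key _ uK su nsu.
  have sgu : sg \subset stellar_car u by rewrite /stellar_car Nu subsetUr.
  have yb : y != b by apply: contraNneq bs => <-.
  rewrite stellar_carU1 N // su; split=> //.
    move: uK; rewrite !mS stellar_carU1 N // => /andP[-> _] /=; rewrite old_partU1.
    by apply/subsetPn; exists y; rewrite // !inE negb_or yb; move: yu; rewrite inE.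
  apply/negP; rewrite sub_old negb_and old_partU1; apply/orP; left.
  by apply/subsetPn; exists y => //; rewrite !inE negb_or yb; move: yu; rewrite inE.
move=> uK su nsu; have [Nu [y ys [yu ysg]]] := key _ uK su nsu.
have Nu' : None \in u by move: Nu; rewrite !inE.
have sgu : sg \subset stellar_car u by rewrite /stellar_car Nu' subsetUr.
move: su; rewrite stellar_carU1 N // => su; split=> // h; apply: nsu.
by apply: subset_trans h _; exact: subsetUr.
Qed.

Lemma stellar_subdivision0 : sg = set0 -> subdivision K (stellar K sg) old_part.
Proof.
move=> s0; have Kd := cK.2.
have mS t : (t \in stellar K sg) = (None \notin t) && (old_part t \in K).
  suff e : stellar_car t = old_part t by rewrite mem_stellar0 // e.
  by rewrite /stellar_car s0; case: ifP => _; rewrite setU0.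
have o0 : old_part set0 = set0 by apply/setP=> x; rewrite !inE.
have cS : is_complex (stellar K sg).
  split; first by rewrite mS o0 inE cK.1.
  move=> s t; rewrite !mS => /andP[ns sK] ts; rewrite (Kd _ _ sK (old_partS ts)) andbT.
  by apply: contra ns; exact: (subsetP ts).
have full (s t : {set option V}) : s \in stellar K sg -> old_part s \subset old_part t -> s \subset t.
  by rewrite mS => /andP[/negbTE ns _] st; rewrite sub_old st ns.
have C : carrier_fun K (stellar K sg) old_part.
  split=> //; [by move=> t; rewrite mS => /andP[] | exact: old_partS |].
  move=> t; rewrite mS => /andP[nt tK]; apply: contra_neq => t0.
  by rewrite -(imset_old_part nt) t0 imset0.
apply: one_step_subdivision => //.
  move=> s sK /set0Pn[x xs]; exists (Some x) => t; rewrite !mS => /andP[nt tK] ts.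
  have e : old_part (Some x |: t) \subset s by rewrite old_partU1 subUset sub1set xs.
  by rewrite !inE /= nt (Kd _ _ sK e).
by move=> s sK [t tK [st []]]; exact: full.
Qed.

Lemma stellar_subdivision : exists car, subdivision K (stellar K sg) car.
Proof.
have [s0|nz] := eqVneq sg set0; first by exists old_part; exact: stellar_subdivision0.
by exists stellar_car; exact: stellar_subdivision_neq0.
Qed.

End Stellar.

(** * Interleaved subdivisions *)

Section Models.
Import GRing.Theory.
Local Open Scope ring_scope.
Variable X : Type.

(** Combinatorial shadow of a triangulation of the bare set [X]: [msp x] is the simplex with [x] in
    its interior, so the open star of [s] consists of the [x] with [s \subset msp x]. *)
Record model := Model {
  mV : finType;
  mK : {set {set mV}};
  msp : X -> {set mV};
  model_complex : is_complex mK;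
  model_sp : forall x, msp x \in mK;
  model_onto : forall s, s \in mK -> s != set0 -> exists x, msp x = s }.

(* The open star of t in n lies in the open star of s in m; the empty simplex of n is
   below the empty simplex of m only, even if some open star is the whole space. *)
Definition open_rel (m n : model) (s : {set mV m}) (t : {set mV n}) : Prop :=
  (forall x, t \subset msp n x -> s \subset msp m x) /\ (t = set0 -> s = set0).

Definition refinement (m n : model) f := chain_map (mK n) (mK m) (@open_rel m n) f.

Definition model_subdivision (m n : model) car :=
  subdivision (mK m) (mK n) car /\ forall x, msp m x = car (msp n x).

Lemma open_rel_trans (m n p : model) s t u :
  @open_rel m n s t -> @open_rel n p t u -> @open_rel m p s u.
Proof. by move=> [h1 h2] [h3 h4]; split; [move=> x /h3/h1 | move=> /h4/h2]. Qed.

Lemma refinement_comp (m n p : model) f g :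
  @refinement m n f -> @refinement n p g -> @refinement m p (mulz f g).
Proof. by move=> cf cg; apply: chain_map_comp cg cf _; exact: open_rel_trans. Qed.

(** For nonempty [t], the simplices whose open star contains that of [t] form a cone: an apex is any
    [v] whose star contains the star of a vertex [w] of [t]. *)
Lemma refinement_exists (m n : model) :
  (forall w, [set w] \in mK n -> exists v, forall x, w \in msp n x -> v \in msp m x) ->
  exists f, @refinement m n f.
Proof.
move=> pi; have [|s t []//||||f cf] := @carrier_map (mV n) (mV m) (mK n) (mK m)
   (fun s t => s \in mK m /\ open_rel s t).
- exact: model_complex.
- move=> s t u _ tu [sK [h1 h2]]; split=> //; split.
    by move=> x ux; apply: h1; exact: subset_trans tu ux.
  by move=> u0; apply: h2; move: tu; rewrite u0 subset0 => /eqP.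
- move=> t tK nt; have /set0Pn[w wt] := nt.
  have [|v vP] := pi w; first by apply: (model_complex n).2 tK _; rewrite sub1set.
  exists v => s [sK [h1 h2]].
  have h x : t \subset msp n x -> v |: s \subset msp m x.
    move=> tx; rewrite subUset sub1set (h1 _ tx) vP //; exact: (subsetP tx).
  split; last by split=> // t0; rewrite t0 eqxx in nt.
  (* [t] is the support of a point [x], so [v |: s] is a face of [msp m x], hence a simplex. *)
  have [x xt] := model_onto tK nt; apply: (model_complex m).2 (model_sp m x) _.
  by apply: h; rewrite xt.
- by split; [exact: (model_complex m).1 | split=> // x _; rewrite sub0set].
by exists f; apply: chain_map_weaken cf _ => s t _ _ [].
Qed.

(** For the forward direction, test the inclusion of open stars at a point whose support is exactly
    [t]. *)
Lemma open_rel_car (m n : model) car s t : @model_subdivision m n car ->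
  t \in mK n -> open_rel s t <-> car_rel car s t.
Proof.
move=> [S e] tK; have C := sub_car S; rewrite /car_rel; split=> [[h1 h2]|st].
  have [t0|/(model_onto tK)[x xt]] := eqVneq t set0; first by rewrite (h2 t0) sub0set.
  by rewrite -xt -e h1 // xt.
split=> [x tx|t0].
  by apply: subset_trans st _; rewrite e; exact: carS C _ _ tx.
by move: st; rewrite t0 (car0 C) subset0 => /eqP.
Qed.

Lemma model_subdivision_id (m : model) : @model_subdivision m m id.
Proof. by split=> //; apply: subdivision_id; exact: model_complex. Qed.

Lemma model_subdivision_comp (m n p : model) c d :
  @model_subdivision m n c -> @model_subdivision n p d -> @model_subdivision m p (c \o d).
Proof.
move=> [S1 e1] [S2 e2]; split; first exact: subdivision_comp S1 S2.
by move=> x; rewrite e1 e2.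
Qed.

Lemma open_rel_id (m : model) s t : t \in mK m -> @open_rel m m s t <-> sub_rel s t.
Proof. exact: (open_rel_car s (model_subdivision_id m)). Qed.

Section RelExt.
Variables (G : zmodType) (V1 V2 : finType) (K1 : {set {set V1}}) (K2 : {set {set V2}}).
Variables (red : bool) (rel rel' : {set V1} -> {set V2} -> Prop).

Lemma E2_sub_ext i j : (forall s t, t \in K2 -> rel s t <-> rel' s t) ->
  qiso (E2 G K1 K2 red rel i j) (E2 G K1 K2 red rel' i j) id.
Proof.
move=> h; have S a b (c : {set V1} -> {set V2} -> G) : supp K1 K2 red rel a b c <-> supp K1 K2 red rel' a b c.
  by split=> hc s t /hc[[? h2 ? ?] ? ?]; split=> //; split=> //; apply/(h s t h2).
have b0 r r' : (forall a b (d : {set V1} -> {set V2} -> G), supp K1 K2 red r a b d -> supp K1 K2 red r' a b d) ->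
    forall d : {set V1} -> {set V2} -> G, bnd K1 K2 red r i j d -> bnd K1 K2 red r' i j d.
  by move=> H d [y [w [sy sw dw e]]]; exists y, w; split=> //; [exact: H _ _ _ sy | exact: H _ _ _ sw].
have z0 r r' : (forall a b (d : {set V1} -> {set V2} -> G), supp K1 K2 red r a b d -> supp K1 K2 red r' a b d) ->
    forall d : {set V1} -> {set V2} -> G, cyc K1 K2 red r i j d -> cyc K1 K2 red r' i j d.
  by move=> H d [sd dd [y [sy e]]]; split; [exact: H _ _ _ sd | by [] | exists y; split=> //; exact: H _ _ _ sy].
have S1 a b c := (S a b c).1; have S2 a b c := (S a b c).2.
split=> //; [exact: z0 S1 | exact: b0 S1 | by move=> c _; exact: b0 S2 c |].
move=> c zc; exists c; first exact: z0 S2 c zc.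
rewrite /= subrr; exists 0, 0; rewrite ract0 lact0 addr0.
by split=> // s t; rewrite eqxx.
Qed.

End RelExt.

(** * Comparison of models through refinements *)

Section Comparison.
Variables (G : zmodType) (red : bool) (i j : int).

Definition E (m n : model) := E2 G (mK m) (mK n) red (@open_rel m n) i j.

Lemma E_lact (m m' n : model) f : @refinement m' m f -> qmor (E m n) (E m' n) (lact f).
Proof. by move=> cf; apply: lact_mor cf => s t u _ _ _; exact: open_rel_trans. Qed.

Lemma E_ract (m n n' : model) f : @refinement n n' f ->
  qmor (E m n) (E m n') (fun c => ract c f).
Proof.
by move=> cf; apply: ract_mor cf => s t u _ _ _ h1 h2; exact: open_rel_trans h2 h1.
Qed.

Lemma refinement_car (m n : model) car f : @model_subdivision m n car ->
  @refinement m n f -> chain_map (mK n) (mK m) (car_rel car) f.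
Proof.
by move=> S cf; apply: chain_map_weaken cf _ => s t _ tK h; exact/(open_rel_car _ S).
Qed.

Lemma E_sub_right (m n : model) car f : @model_subdivision m n car -> @refinement m n f ->
  qiso (E m m) (E m n) (fun c => ract c f).
Proof.
move=> S cf; have cf' := refinement_car S cf.
have I1 : qiso (E m m) (E2 G (mK m) (mK m) red (@sub_rel _) i j) id.
  by apply: E2_sub_ext => s t; exact: open_rel_id.
have I2 : qiso (E2 G (mK m) (mK n) red (car_rel car) i j) (E m n) id.
  by apply: E2_sub_ext => s t tK; split=> /(open_rel_car _ S tK).
have J : qiso (E2 G (mK m) (mK m) red (@sub_rel _) i j)
     (E2 G (mK m) (mK n) red (car_rel car) i j) (fun c => ract c f).
  apply: (@sub_right _ _ _ _ _ S.1 G _ _ red (@sub_rel _) f i j _ cf').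
  by move=> a s t _ st h; exact: subset_trans h st.
exact: (qiso_comp (qiso_comp I1 J) I2).
Qed.

Lemma E_sub_left (m n : model) car f : @model_subdivision m n car -> @refinement m n f ->
  qiso (E n n) (E m n) (lact f).
Proof.
move=> S cf; have cf' := refinement_car S cf.
have I1 : qiso (E n n) (E2 G (mK n) (mK n) red (@sub_rel _) i j) id.
  by apply: E2_sub_ext => s t; exact: open_rel_id.
have I2 : qiso (E2 G (mK m) (mK n) red (car_rel car) i j) (E m n) id.
  by apply: E2_sub_ext => s t tK; split=> /(open_rel_car _ S tK).
exact: (qiso_comp (qiso_comp I1 (sub_left S.1 G red i j cf')) I2).
Qed.

Lemma E_sub_right2 (m n p : model) c d f g : @model_subdivision m n c ->
  @model_subdivision n p d -> @refinement m n f -> @refinement n p g ->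
  qiso (E m n) (E m p) (fun c => ract c g).
Proof.
move=> S1 S2 cf cg; apply: (qiso_cancel_right (E_sub_right S1 cf) (E_ract _ cg)).
have -> : (fun c : {set mV m} -> {set mV n} -> G => ract c g) \o
          (fun c : {set mV m} -> {set mV m} -> G => ract c f) = (fun c => ract c (mulz f g)).
  by apply/funext=> u /=; rewrite ract_assoc.
exact: E_sub_right (model_subdivision_comp S1 S2) (refinement_comp cf cg).
Qed.

(** Injectivity is seen after mapping on to E(m0,m2), surjectivity after mapping on to E(n0,n2);
    both continuations return to isomorphisms attached to subdivisions. *)
Lemma interleaving (m0 m1 m2 n0 n1 n2 : model) c1 c2 d1 d2 f0 g0 f1 g1 f2 :
  @model_subdivision m0 m1 c1 -> @model_subdivision m1 m2 c2 ->
  @model_subdivision n0 n1 d1 -> @model_subdivision n1 n2 d2 ->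
  @refinement m0 n0 f0 -> @refinement n0 m1 g0 -> @refinement m1 n1 f1 ->
  @refinement n1 m2 g1 -> @refinement m2 n2 f2 ->
  qiso (E m1 m1) (E n0 n1) (fun c => lact g0 (ract c f1)).
Proof.
move=> S1 S2 T1 T2 F0 G0 F1 G1 F2.
have [phB phz phb] := qmor_comp (E_ract m1 F1) (E_lact n1 G0).
split=> // [c zc bc|b zb].
  have L := qiso_comp (E_sub_left S1 (refinement_comp F0 G0))
    (E_sub_right2 S1 S2 (refinement_comp F0 G0) (refinement_comp F1 G1)).
  apply: (qiso_inj L zc) => /=.
  have := qmorb (E_ract m0 G1) (qmorb (E_lact n1 F0) bc).
  by rewrite /= lact_assoc !lract ract_assoc.
(* A preimage of [b] is found along E(n0,n1) <- E(n1,n1) -> E(m1,m2) <- E(m1,m1), where the outer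
   arrows are isomorphisms. *)
have [b' zb' bb'] := qiso_surj (E_sub_left T1 (refinement_comp G0 F1)) zb.
pose e := lact f1 (ract b' g1).
have ze : zq (E m1 m2) e := qmorz (E_lact m2 F1) (qmorz (E_ract n1 G1) zb').
have [a za ba] := qiso_surj (E_sub_right S2 (refinement_comp F1 G1)) ze.
exists a => //.
(* [R] is an isomorphism E(n0,n1) -> E(n0,n2), so the equality of classes may be checked in its
   target, where all actions associate. *)
have R := E_sub_right2 T1 T2 (refinement_comp G0 F1) (refinement_comp G1 F2).
apply: (qiso_inj R); first by apply: zqB zb _; exact: phz.
have h1 := qisob R bb'; rewrite !(qisoB R) in h1 *.
apply: bq_trans h1 _.
have := qmorb (E_lact n2 G0) (qmorb (E_ract m1 F2) ba).
rewrite ractB lactB /e; congr (bq _ (_ - _)).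
- by rewrite !lract lact_assoc !ract_assoc.
- by rewrite !lract !ract_assoc.
Qed.

End Comparison.

Lemma interleaving_LH (G : zmodType) red i j
    (m0 m1 m2 n0 n1 n2 : model) c1 c2 d1 d2 f0 g0 f1 g1 f2 :
  @model_subdivision m0 m1 c1 -> @model_subdivision m1 m2 c2 ->
  @model_subdivision n0 n1 d1 -> @model_subdivision n1 n2 d2 ->
  @refinement m0 n0 f0 -> @refinement n0 m1 g0 -> @refinement m1 n1 f1 ->
  @refinement n1 m2 g1 -> @refinement m2 n2 f2 ->
  zmod_iso (LH G (mK m1) red i j) (LH G (mK n1) red i j).
Proof.
move=> S1 S2 T1 T2 F0 G0 F1 G1 F2.
have J m : qiso (E2 G (mK m) (mK m) red (@sub_rel _) i j) (E G red i j m m) id.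
  by apply: E2_sub_ext => s t tK; split=> /(open_rel_id _ tK).
apply: (LH_iso_zigzag (model_complex m1) (model_complex n1)).
  apply: qiso_comp (J _) (interleaving _ _ _ _ S1 S2 T1 T2 F0 G0 F1 G1 F2).
exact: qiso_comp (J _) (E_sub_left _ _ _ _ T1 (refinement_comp G0 F1)).
Qed.

End Models.

Lemma zmod_iso_sym (A B : zmodType) : zmod_iso A B -> zmod_iso B A.
Proof.
move=> [f [fD [g fg gf]]]; exists g; split; last by exists f.
by move=> x y; rewrite -{1}[x]gf -{1}[y]gf -fD fg.
Qed.

Lemma zmod_iso_trans (A B C : zmodType) : zmod_iso A B -> zmod_iso B C -> zmod_iso A C.
Proof.
move=> [f [fD bf]] [g [gD bg]]; exists (g \o f); split; last exact: bij_comp.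
by move=> x y /=; rewrite fD gD.
Qed.

(** * Barycentric coordinates and edge bisection *)

Section Coordinates.
Import Order.TTheory GRing.Theory Num.Theory.
Local Open Scope ring_scope.

Lemma sum_option (M : nmodType) (V : finType) (F : option V -> M) :
  \sum_o F o = F None + \sum_v F (Some v).
Proof.
rewrite (bigD1 None) //=; congr (_ + _).
rewrite (reindex_omap Some id) //=; first by apply: eq_bigl => v; rewrite eqxx.
by case.
Qed.

Lemma set2_old (V : finType) (u w : V) : old_part [set Some u; Some w] = [set u; w].
Proof. by apply/setP=> x; rewrite !inE !(inj_eq (@Some_inj _)). Qed.

Variables (R : realFieldType) (X : Type).

(** Barycentric coordinates of a triangulation with the topology forgotten; [controls] supplies what
    is needed of it. *)
Record coords := Coords {
  cV : finType;
  cK : {set {set cV}};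
  cb : X -> cV -> R;
  c_complex : is_complex cK;
  cb_ge0 : forall x v, 0 <= cb x v;
  cb_sum : forall x, \sum_v cb x v = 1;
  cb_supp : forall x, [set v | 0 < cb x v] \in cK;
  cb_onto : forall l : cV -> R, (forall v, 0 <= l v) -> \sum_v l v = 1 ->
    [set v | 0 < l v] \in cK -> exists x, forall v, cb x v = l v }.

Arguments cb : clear implicits.

Definition csupp (c : coords) x := [set v | 0 < cb c x v].

Lemma csupp_onto (c : coords) s : s \in cK c -> s != set0 -> exists x, csupp c x = s.
Proof.
move=> sK nz; have cs : (0 : R) < #|s|%:R by rewrite ltr0n card_gt0.
(* The barycenter of [s]. *)
pose l v : R := if v \in s then #|s|%:R^-1 else 0.
have lE v : (0 < l v) = (v \in s).
  by rewrite /l; case: ifP => _; rewrite ?invr_gt0 ?ltxx.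
have [v|||x xl] := @cb_onto c l.
- by rewrite /l; case: ifP => // _; rewrite invr_ge0 ler0n.
- rewrite -big_mkcond /= sumr_const -[_ *+ _]mulr_natl divff //; exact: lt0r_neq0.
- by rewrite (_ : [set v | _] = s) //; apply/setP=> v; rewrite inE lE.
by exists x; apply/setP=> v; rewrite inE xl lE.
Qed.

Definition cmodel (c : coords) : model X :=
  Model (c_complex c) (cb_supp c) (@csupp_onto c).

(** The coordinates of [d] depend uniformly continuously on those of [c]. *)
Definition controls (c d : coords) := forall e : R, 0 < e ->
  exists2 de : R, 0 < de & forall x y, (forall v, `|cb c x v - cb c y v| < de) ->
    forall w, `|cb d x w - cb d y w| < e.

Lemma controls_refl c : controls c c. Proof. by move=> e e0; exists e. Qed.

Lemma controls_trans c d f : controls c d -> controls d f -> controls c f.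
Proof.
move=> h1 h2 e /h2[d1 /h1[d2 d20 h3] h4]; exists d2 => // x y h w.
by apply: h4; exact: h3.
Qed.

(** * Bisection of one edge in barycentric coordinates *)

Section EdgeStep.
Variables (c : coords) (a b : cV c).
Hypothesis ab : a != b.

Local Notation e := [set a; b].
Let m x := Num.min (cb c x a) (cb c x b).

(** The common part [m x] of the weights of [a] and [b] is taken from both ends and given to the
    midpoint, which receives it twice. *)
Definition edge_b x (o : option (cV c)) : R :=
  if o is Some v then cb c x v - (if v \in e then m x else 0) else 2 * m x.

Lemma sum_edge (r : R) (F : cV c -> R) :
  \sum_v (if v \in e then r else 0) * F v = r * F a + r * F b.
Proof.
rewrite (bigD1 a) //= (bigD1 b) 1?eq_sym //= big1 ?addr0.
  by rewrite !inE !eqxx orbT.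
by move=> v /andP[va vb]; rewrite !inE (negbTE va) (negbTE vb) mul0r.
Qed.

Lemma m_ge0 x : 0 <= m x. Proof. by rewrite le_min !cb_ge0. Qed.

Lemma m_le x v : v \in e -> m x <= cb c x v.
Proof. by rewrite !inE /m => /orP[] /eqP ->; rewrite ge_min lexx ?orbT. Qed.

Lemma edge_ge0 x o : 0 <= edge_b x o.
Proof.
case: o => [v|] /=; last by rewrite mulr_ge0 ?m_ge0.
by case: ifP => [/(m_le x)|_]; rewrite subr_ge0 ?cb_ge0.
Qed.

Lemma edge_sum x : \sum_o edge_b x o = 1.
Proof.
rewrite sum_option /= sumrB cb_sum.
under [X in _ - X]eq_bigr => v _ do rewrite -[(if _ then _ else _)]mulr1.
rewrite (sum_edge (m x) (fun=> 1)); lra.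
Qed.

Lemma edge_nz : e != set0.
Proof. by apply/set0Pn; exists a; rewrite !inE eqxx. Qed.

Lemma edge_old x v : (v \in old_part [set o | 0 < edge_b x o]) =
  ((if v \in e then m x else 0) < cb c x v).
Proof. by rewrite [LHS]inE [LHS]inE /= subr_gt0. Qed.

Lemma edge_None x : (None \in [set o | 0 < edge_b x o]) = (0 < m x).
Proof. by rewrite inE /= pmulr_rgt0 // ltr0n. Qed.

Lemma edge_car x : csupp c x = stellar_car e [set o | 0 < edge_b x o].
Proof.
apply/setP=> v; rewrite inE in_setU edge_old edge_None.
have [m0|nm0] := boolP (0 < m x); last first.
  have -> : m x = 0 by apply/eqP; rewrite eq_le m_ge0 andbT leNgt.
  by rewrite in_set0 orbF; case: ifP.
have [ve|nve] := boolP (v \in e); last by rewrite orbF.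
by rewrite orbT; apply: lt_le_trans m0 (m_le x ve).
Qed.

(** The end with the smaller weight is left with 0, so no support contains both ends. *)
Lemma edge_supp x : [set o | 0 < edge_b x o] \in stellar (cK c) e.
Proof.
rewrite (mem_stellar (c_complex c) _ edge_nz).
rewrite -edge_car cb_supp /=.
apply/negP => /subsetP h; have := h a; have := h b.
rewrite !edge_old !inE !eqxx orbT /= => /(_ isT) h1 /(_ isT).
by apply/negP; rewrite -leNgt; move: h1; rewrite /m minElt; case: ifP; rewrite ?ltxx.
Qed.

Lemma edge_onto (l : option (cV c) -> R) : (forall o, 0 <= l o) -> \sum_o l o = 1 ->
  [set o | 0 < l o] \in stellar (cK c) e -> exists x, forall o, edge_b x o = l o.
Proof.
move=> l0 l1; rewrite (mem_stellar (c_complex c) _ edge_nz).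
move=> /andP[lK nl].
(* The old coordinates are recovered by returning half of the midpoint's weight to each end. *)
pose k v := l (Some v) + (if v \in e then l None / 2 else 0).
have l00 := l0 None.
have kE : [set v | 0 < k v] = stellar_car e [set o | 0 < l o].
  apply/setP=> v; rewrite /stellar_car !inE /k; have lv := l0 (Some v).
  have [N0|N0] := boolP (0 < l None).
    have h : 0 < l None / 2 by rewrite divr_gt0.
    rewrite !inE; case: ifP => ve; last by rewrite addr0 orbF.
    by rewrite orbT ltr_wpDl.
  have -> : l None = 0 by apply/eqP; rewrite eq_le l00 andbT leNgt.
  by rewrite mul0r if_same addr0 inE orbF.
have [v|||x xP] := @cb_onto c k.
- by rewrite addr_ge0 //; case: ifP => // _; rewrite divr_ge0.
- rewrite big_split /= -[RHS]l1 sum_option addrC; congr (_ + _).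
  under eq_bigr => v _ do rewrite -[(if _ then _ else _)]mulr1.
  rewrite (sum_edge (l None / 2) (fun=> 1)); lra.
- by rewrite kE.
exists x; have mE : m x = l None / 2.
  rewrite /m !xP /k !inE !eqxx orbT /=.
  have la := l0 (Some a); have lb := l0 (Some b).
  (* The bisected edge is no longer a simplex, so one end has weight 0 and the minimum is exactly
     the returned half. *)
  have [a0|b0] : l (Some a) = 0 \/ l (Some b) = 0.
    have [->|na] := eqVneq (l (Some a)) 0; first by left.
    have [->|nb] := eqVneq (l (Some b)) 0; first by right.
    by case/negP: nl; apply/subsetP=> v; rewrite !inE => /orP[] /eqP ->; rewrite lt0r ?na ?nb.
  - by rewrite a0 add0r min_l // lerDr.
  - by rewrite b0 add0r min_r // lerDr.
case=> [v|] /=; last by rewrite mE mulrC divfK ?pnatr_eq0.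
by rewrite xP /k mE; case: ifP => _; rewrite ?addrK ?addr0 ?subr0.
Qed.

Lemma edge_complex : is_complex (stellar (cK c) e).
Proof.
exact: car_c1 (sub_car (stellar_subdivision_neq0 (c_complex c) edge_nz)).
Qed.

Definition edge_coords : coords :=
  Coords edge_complex edge_ge0 edge_sum edge_supp edge_onto.

Lemma edge_subdivision : @model_subdivision X (cmodel c) (cmodel edge_coords) (stellar_car e).
Proof.
split; last exact: edge_car.
by apply: stellar_subdivision_neq0; [exact: c_complex | exact: edge_nz].
Qed.

Lemma edge_controls : controls c edge_coords.
Proof.
move=> r r0; exists (r / 4); first by lra.
move=> x y h; have mm : `|m x - m y| < r / 4.
  have := h a; have := h b; rewrite /m !ltr_norml => /andP[? ?] /andP[? ?].
  rewrite !minElt; case: (ltP (cb c x a) (cb c x b)) => ?; case: (ltP (cb c y a) (cb c y b)) => ?; apply/andP; split; lra.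
case=> [v|] /=; move: mm; last by rewrite !ltr_norml => /andP[? ?]; apply/andP; split; lra.
have := h v; rewrite !ltr_norml => /andP[? ?] /andP[? ?].
by case: ifP => _; apply/andP; split; lra.
Qed.

Lemma edge_controlled : controls edge_coords c.
Proof.
move=> r r0; exists (r / 4); first by lra.
move=> x y h v; have := h None; have := h (Some v); rewrite /= !ltr_norml.
by case: ifP => _ /andP[? ?] /andP[? ?]; apply/andP; split; lra.
Qed.

Section Positions.
Variables (I : finType) (p : cV c -> I -> R).

(** With the new vertex at the midpoint, every point keeps its position ([edge_posE]). *)
Definition edge_pos (o : option (cV c)) (k : I) : R :=
  if o is Some v then p v k else (p a k + p b k) / 2.

Lemma edge_posE x k : \sum_o edge_b x o * edge_pos o k = \sum_v cb c x v * p v k.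
Proof.
rewrite sum_option /=; under eq_bigr => v _ do rewrite mulrBl.
by rewrite sumrB (sum_edge (m x) (fun v => p v k)); lra.
Qed.

End Positions.

End EdgeStep.

End Coordinates.

Arguments cb {R X} c x v.

(** * Mesh of iterated edge bisections *)

Section Mesh.
Import Order.TTheory GRing.Theory Num.Theory.
Local Open Scope ring_scope.
Variables (R : archiRealFieldType) (X : Type) (c0 : coords R X).

Local Notation I := (cV c0).

Definition sqlen (W : Type) (p : W -> I -> R) u w := \sum_k (p u k - p w k) ^+ 2.

Lemma sqlen_ge0 W (p : W -> I -> R) u w : 0 <= sqlen p u w.
Proof. by apply: sumr_ge0 => k _; exact: sqr_ge0. Qed.

Lemma sqlenxx W (p : W -> I -> R) u : sqlen p u u = 0.
Proof. by rewrite /sqlen big1 // => k _; rewrite subrr expr0n. Qed.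

Lemma sqlenC W (p : W -> I -> R) u w : sqlen p u w = sqlen p w u.
Proof. by apply: eq_bigr => k _; rewrite -sqrrN opprB. Qed.

(** Invariant of the bisection process; the last clause says that the vertex positions [p] reproduce
    the original coordinates of every point. *)
Definition reached (c : coords R X) (p : cV c -> I -> R) :=
  [/\ exists car, @model_subdivision X (cmodel c0) (cmodel c) car,
      controls c0 c, controls c c0 &
      forall x k, \sum_v cb c x v * p v k = cb c0 x k].

Definition fine (c : coords R X) (p : cV c -> I -> R) (M : R) :=
  forall u w, [set u; w] \in cK c -> sqlen p u w <= M.

Definition longs (c : coords R X) (p : cV c -> I -> R) (M : R) :=
  [set s in cK c | [exists u, exists w, (s == [set u; w]) && (13 / 16 * M < sqlen p u w)]].

Section OneEdge.
Variables (c : coords R X) (p : cV c -> I -> R) (M : R) (a b : cV c).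
Hypotheses (ab : a != b) (M0 : 0 <= M) (fM : fine p M).
Hypotheses (abK : [set a; b] \in cK c) (long : 13 / 16 * M < sqlen p a b).

Local Notation c' := (edge_coords ab).
Local Notation p' := (edge_pos a b p).

Lemma reached_edge : reached p -> reached (c := c') p'.
Proof.
move=> [[car S] h1 h2 h3]; split.
- by exists (car \o stellar_car [set a; b]); exact: model_subdivision_comp S (edge_subdivision ab).
- exact: controls_trans h1 (edge_controls ab).
- exact: controls_trans (edge_controlled ab) h2.
- by move=> x k; rewrite -h3; exact: edge_posE.
Qed.

Lemma sqlen_Some u w : sqlen p' (Some u) (Some w) = sqlen p u w.
Proof. by []. Qed.

(* The median formula: this is what makes the bisection of long edges effective. *)
Lemma sqlen_None w : sqlen p' None (Some w) =
  (sqlen p a w + sqlen p b w) / 2 - sqlen p a b / 4.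
Proof.
rewrite /sqlen -big_split /= !mulr_suml -sumrB; apply: eq_bigr => k _; lra.
Qed.

Lemma edge_mem s : s \in cK c' ->
  stellar_car [set a; b] s \in cK c /\ ~~ ([set a; b] \subset old_part s).
Proof. by rewrite [_ \in _](mem_stellar (c_complex c) _ (edge_nz a b)) => /andP[]. Qed.

Lemma fine_None w : [set None; Some w] \in cK c' -> sqlen p' None (Some w) <= 13 / 16 * M.
Proof.
move=> /edge_mem[h _]; have sK u : [set u; w] \subset stellar_car [set a; b] [set None; Some w] ->
    sqlen p u w <= M by move=> hs; apply: fM; exact: (c_complex c).2 h hs.
have ha : sqlen p a w <= M.
  by apply: sK; rewrite subUset !sub1set !inE !eqxx ?orbT.
have hb : sqlen p b w <= M.
  by apply: sK; rewrite subUset !sub1set !inE !eqxx ?orbT.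
(* The bound obtained is M - (13/16) M / 4 = (51/64) M, below (52/64) M = (13/16) M. *)
rewrite sqlen_None; move: M0 long ha hb.
move: (sqlen p a w) (sqlen p b w) (sqlen p a b) => A B L; lra.
Qed.

Lemma old_Some (u w : cV c) : [set Some u; Some w] \in cK c' ->
  [set u; w] \in cK c /\ [set u; w] != [set a; b].
Proof.
move=> /edge_mem[]; rewrite /stellar_car set2_old !inE /= setU0 => h n; split=> //.
by apply: contra n => /eqP ->.
Qed.

Lemma edge_cases u w : [set u; w] \in cK c' -> 13 / 16 * M < sqlen p' u w ->
  exists u0 w0, [/\ u = Some u0, w = Some w0, [set u0; w0] \in cK c &
                    [set u0; w0] != [set a; b]].
Proof.
case: u w => [u|] [w|]; first by move=> /old_Some[h1 h2] _; exists u, w.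
- rewrite setUC sqlenC => /fine_None h1 h2.
  by have := lt_le_trans h2 h1; rewrite ltxx.
- by move=> /fine_None h1 h2; have := lt_le_trans h2 h1; rewrite ltxx.
- by rewrite sqlenxx; move: M0; lra.
Qed.

Lemma fine_edge : fine (c := c') p' M.
Proof.
move=> u w uwK; rewrite leNgt; apply/negP => h.
have [|u0 [w0 [eu ew h1 _]]] := edge_cases uwK; first by move: M0 h; lra.
by move: h; rewrite eu ew sqlen_Some ltNge fM.
Qed.

(** Every long edge after the bisection is an old one other than the bisected edge. This count is
    the termination measure of [bisect_all]. *)
Lemma longs_edge : (#|longs (c := c') p' M| < #|longs p M|)%N.
Proof.
have abL : [set a; b] \in longs p M.
  by rewrite inE abK /=; apply/existsP; exists a; apply/existsP; exists b; rewrite eqxx.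
rewrite (cardsD1 [set a; b] (longs p M)) abL add1n ltnS.
apply: leq_trans (leq_imset_card (fun s : {set cV c} => [set Some x | x in s]) _).
apply/subset_leq_card/subsetP => s; rewrite inE => /andP[sK /existsP[u /existsP[w /andP[/eqP es h]]]].
rewrite es in sK *; have [u0 [w0 [eu ew uwK ne]]] := edge_cases sK h.
apply/imsetP; exists [set u0; w0]; last by rewrite eu ew imsetU1 imset_set1.
rewrite in_setD1 ne inE uwK /=; apply/existsP; exists u0; apply/existsP; exists w0.
by move: h; rewrite eqxx eu ew sqlen_Some.
Qed.

End OneEdge.

Lemma bisect_all (c : coords R X) p M : 0 <= M -> reached (c := c) p -> fine p M ->
  exists c1 p1, reached (c := c1) p1 /\ fine p1 (13 / 16 * M).
Proof.
move=> M0; have [n] := ubnP #|longs p M|; elim: n c p => // n IH c p; rewrite ltnS => ln rp fp.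
have [[u [w [uwK h]]]|nh] := pselect (exists u w, [set u; w] \in cK c /\ 13 / 16 * M < sqlen p u w).
  have uw : u != w.
    by apply: contraTneq h => ->; rewrite sqlenxx -leNgt; move: M0; lra.
  apply: (IH (edge_coords uw) (edge_pos u w p)).
  - exact: leq_trans (longs_edge uw M0 fp uwK h) ln.
  - exact: reached_edge.
  - exact: fine_edge.
exists c, p; split=> // u w uwK; rewrite leNgt; apply/negP => h.
by apply: nh; exists u, w.
Qed.

Lemma fine_iter M (n : nat) : 0 <= M -> (exists p : I -> I -> R, reached p /\ fine p M) ->
  exists c1 p1, reached (c := c1) p1 /\ fine p1 ((13 / 16) ^+ n * M).
Proof.
move=> M0 [p [rp fp]]; elim: n => [|n [c [q [rq fq]]]].
  by exists c0, p; rewrite expr0 mul1r.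
have [|c1 [p1 [r1 f1]]] := bisect_all _ rq fq.
  by rewrite mulr_ge0 // exprn_ge0 //; lra.
by exists c1, p1; rewrite exprS -mulrA.
Qed.

Lemma geometric_small (M e : R) : 0 <= M -> 0 < e -> exists n, (13 / 16) ^+ n * M < e.
Proof.
move=> M0 e0.
(* Bernoulli's inequality for the ratio 16/13 = 1 + 3/13. *)
have bern n : (13 / 16) ^+ n * (1 + n%:R * (3 / 13)) <= 1 :> R.
  elim: n => [|n IH]; first by rewrite expr0; lra.
  apply: le_trans IH; rewrite exprS -mulrA [13 / 16 * _]mulrCA.
  apply: ler_wpM2l; first by apply: exprn_ge0; lra.
  have : 0 <= n%:R :> R by rewrite ler0n.
  rewrite -[n.+1%:R]natr1; lra.
have [n nP] : exists n : nat, M * 13 / (3 * e) < n%:R.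
  exists (Num.bound (M * 13 / (3 * e))); apply: archi_boundP.
  by rewrite divr_ge0 ?mulr_ge0 //; lra.
exists n; have := bern n; have q0 : 0 <= (13 / 16) ^+ n :> R by apply: exprn_ge0; lra.
move: nP; rewrite ltr_pdivrMr; last by lra.
move=> nP h; move: q0 h; set q := _ ^+ n => q0 h.
have [->|qn] := eqVneq q 0; first by rewrite mul0r.
have q1 : 0 < q by rewrite lt0r qn.
have : q * (M * 13) < q * (n%:R * (3 * e)) by rewrite ltr_pM2l.
have : e * (q * (1 + n%:R * (3 / 13))) <= e * 1 by rewrite ler_pM2l.
have : 0 < e * q by rewrite mulr_gt0.
nra.
Qed.

Definition small_stars (c : coords R X) (e : R) := forall w x y,
  0 < cb c x w -> 0 < cb c y w -> forall k, `|cb c0 x k - cb c0 y k| < e.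

Lemma small_subdivision (e : R) : 0 < e -> exists2 c : coords R X,
   exists car, @model_subdivision X (cmodel c0) (cmodel c) car &
   [/\ controls c0 c, controls c c0 & small_stars c e].
Proof.
move=> e0; pose p (u k : I) : R := (u == k)%:R.
have rp : reached p.
  split; [by exists id; exact: model_subdivision_id | exact: controls_refl | exact: controls_refl |].
  move=> x k; rewrite (bigD1 k) //= big1 ?addr0; first by rewrite /p eqxx mulr1.
  by move=> v /negbTE nv; rewrite /p nv mulr0.
(* A crude bound on all squared lengths at the start, where the vertices are the standard basis
   vectors. *)
pose M := \sum_u \sum_w sqlen p u w.
have M0 : 0 <= M by apply: sumr_ge0 => u _; apply: sumr_ge0 => w _; exact: sqlen_ge0.
have fp : fine p M.
  move=> u w _; rewrite /M (bigD1 u) //= (bigD1 w) //= -addrA lerDl addr_ge0 //.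
    by apply: sumr_ge0 => *; exact: sqlen_ge0.
  by apply: sumr_ge0 => *; apply: sumr_ge0 => *; exact: sqlen_ge0.
(* Each point of a star will be within e/4 of its center, so two such points differ by at most e/2
   in every coordinate. *)
have e4 : 0 < (e / 4) ^+ 2 by rewrite exprn_gt0 // divr_gt0.
have [n nP] := geometric_small M0 e4.
have [|c [q [[S h1 h2 h3] fq]]] := @fine_iter M n M0; first by exists p.
exists c => //; split=> //.
(* The point is a convex combination of the vertices [v] of its support, each joined to [w] by an
   edge. *)
have star w x k : 0 < cb c x w -> `|cb c0 x k - q w k| <= e / 4.
  move=> xw; rewrite -h3.
  have -> : \sum_v cb c x v * q v k - q w k = \sum_v cb c x v * (q v k - q w k).
    under [RHS]eq_bigr => v _ do rewrite mulrBr.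
    by rewrite sumrB -mulr_suml cb_sum mul1r.
  apply: le_trans (ler_norm_sum _ _ _) _.
  have -> : e / 4 = \sum_v cb c x v * (e / 4) by rewrite -mulr_suml cb_sum mul1r.
  apply: ler_sum => v _.
  rewrite normrM ger0_norm ?cb_ge0 //.
  have [->|nv] := eqVneq (cb c x v) 0; first by rewrite !mul0r.
  apply: ler_wpM2l; first exact: cb_ge0.
  have vw : [set v; w] \in cK c.
    apply: (c_complex c).2 (cb_supp c x) _; rewrite subUset !sub1set !inE xw andbT.
    by rewrite lt0r nv cb_ge0.
  have e40 : 0 <= e / 4 by lra.
  rewrite -(@ler_pXn2r _ 2) ?nnegrE //.
  rewrite -normrX ger0_norm ?sqr_ge0 //.
  apply: le_trans (ltW nP); apply: le_trans (fq _ _ vw).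
  rewrite /sqlen (bigD1 k) //= lerDl; apply: sumr_ge0 => ? _; exact: sqr_ge0.
move=> w x y xw yw k; have := star w x k xw; have := star w y k yw.
rewrite !ler_norml ltr_norml => /andP[? ?] /andP[? ?]; apply/andP; split; lra.
Qed.

(** A Lebesgue number argument: every point has some [d]-weight at least 1/N, and the stars of [c]
    are made so small that weights vary by less than 1/N on each of them. *)
Lemma common_control (d : coords R X) : inhabited X -> controls c0 d ->
  exists2 c : coords R X, exists car, @model_subdivision X (cmodel c0) (cmodel c) car &
    [/\ controls c0 c, controls c c0 & exists f, @refinement X (cmodel d) (cmodel c) f].
Proof.
move=> [x0] cd; pose N := #|cV d|.
have big x : exists v, N%:R^-1 <= cb d x v.
  apply: contrapT => /forallNP h; have := cb_sum d x.
  have [v0 _|nov] := pickP (fun v : cV d => true); last first.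
    by rewrite (eq_bigl _ _ nov) big_pred0_eq => /eqP; rewrite eq_sym oner_eq0.
  move=> s1; have : \sum_v cb d x v < \sum_(v : cV d) N%:R^-1.
    apply: ltr_sum; last by move=> v _; rewrite ltNge; apply/negP; exact: h.
    by apply/hasP; exists v0; rewrite ?mem_index_enum.
  rewrite s1 sumr_const -[_ *+ _]mulr_natl divff ?ltxx //.
  by rewrite pnatr_eq0 -lt0n; apply/card_gt0P; exists v0.
have N0 : 0 < N%:R^-1 :> R.
  by rewrite invr_gt0 ltr0n; have [v _] := big x0; apply/card_gt0P; exists v.
have [de de0 hde] := cd _ N0.
have [c S [h1 h2 sm]] := small_subdivision de0.
exists c => //; split=> //; apply: refinement_exists => w wK.
have nw : [set w] != set0 by apply/set0Pn; exists w; exact: set11.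
have [x xw] := csupp_onto wK nw.
(* The weight of [v] at [x] is at least 1/N, so it stays positive on the whole star of [w]. *)
have [v vP] := big x; exists v => y; rewrite !inE => yw.
have xw0 : 0 < cb c x w by have := set11 w; rewrite -xw inE.
have := hde x y (sm w x y xw0 yw) v; rewrite ltr_norml => /andP[_ ?].
by move: vP; lra.
Qed.

End Mesh.

Section Interleave.
Variables (R : archiRealFieldType) (X : Type) (G : zmodType).
Import Order.TTheory GRing.Theory Num.Theory.

(** Here [c] itself serves as m0, and the chain n0, m1, n1, m2, n2 is built alternately from [d] and
    [c] by [common_control]. *)
Lemma coords_LH (c d : coords R X) red i j : inhabited X -> controls c d -> controls d c ->
  zmod_iso (LH G (cK c) red i j) (LH G (cK d) red i j).
Proof.
move=> x0 cd dc.
have [n0 [cn0 T0] [t1 t2 [f0 F0]]] := common_control x0 dc.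
have [m1 [cm1 S1] [s1 s2 [g0 G0]]] := common_control x0 (controls_trans cd t1).
have [n1 [cn1 T1] [t3 t4 [f1 F1]]] := common_control x0 (controls_trans t2 (controls_trans dc s1)).
have m1n0 := controls_trans s2 (controls_trans cd t1).
have [m2 [cm2 S2] [s3 s4 [g1 G1]]] := common_control x0 (controls_trans m1n0 t3).
have n1m2 := controls_trans t4 (controls_trans (controls_trans t2 (controls_trans dc s1)) s3).
have [n2 [cn2 T2] [_ _ [f2 F2]]] := common_control x0 n1m2.
have J := interleaving_LH G red i j S1 S2 T1 T2 F0 G0 F1 G1 F2.
apply: zmod_iso_trans (subdivision_LH G red i j S1.1) _.
apply: zmod_iso_trans J _; apply: zmod_iso_sym.
exact: zmod_iso_trans (subdivision_LH G red i j T0.1) (subdivision_LH G red i j T1.1).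
Qed.

End Interleave.

(** * Triangulations *)

From mathcomp Require Import classical_sets reals topology normedtype.
From mathcomp Require Import matrix_topology matrix_normedtype.

(** * Compactness of realizations and uniform continuity *)

Section Realization.
Import Order.TTheory GRing.Theory Num.Theory.
Import numFieldTopology.Exports numFieldNormedType.Exports.
Local Open Scope ring_scope.
Local Open Scope classical_set_scope.
Variables (R : realType) (V : finType) (K : {set {set V}}).
Hypothesis cK : is_complex K.

Local Notation crd y v := ((y : 'rV[R]_#|V|) ord0 (enum_rank v)).

Lemma basis_sum (P : {set V}) (lam : V -> R) u :
  crd (\sum_(v in P) lam v *: basis_vec R v) u = if u \in P then lam u else 0.
Proof.
rewrite summxE; under eq_bigr => v _ do rewrite !mxE eqxx /=.
case: ifP => uP.
  rewrite (bigD1 u) //= eqxx mulr1 big1 ?addr0 // => v /andP[_ nv].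
  by rewrite (inj_eq enum_rank_inj) eq_sym (negbTE nv) mulr0.
rewrite big1 // => v vP; rewrite (inj_eq enum_rank_inj).
case: eqP => [e|_]; last by rewrite mulr0.
by rewrite e vP in uP.
Qed.

Definition bary (y : 'rV[R]_#|V|) :=
  [/\ forall v, 0 <= crd y v, \sum_v crd y v = 1 & [set v | 0 < crd y v]%SET \in K].

Lemma realizationP y : @realization R V K y <-> bary y.
Proof.
split=> [[sg sgK [lam [l0 l1 ey]]]|[y0 y1 yK]].
  have yE v : crd y v = if v \in sg then lam v else 0 by rewrite ey basis_sum.
  split.
  - by move=> v; rewrite yE; case: ifP.
  - by under eq_bigr => v _ do rewrite yE; rewrite -big_mkcond.
  - apply: cK.2 sgK _; apply/fintype.subsetP=> v; rewrite inE yE; case: ifP => //.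
    by rewrite ltxx.
have z v : (v \in [set v | 0 < crd y v]%SET) = false -> crd y v = 0.
  by rewrite inE => /negbT nv; apply/eqP; rewrite eq_le y0 andbT leNgt.
exists [set v | 0 < crd y v]%SET => //; exists (fun v => crd y v); split=> //.
  rewrite -[RHS]y1 [LHS]big_mkcond; apply: eq_bigr => v _.
  by case: ifP => // /z ->.
apply/rowP => i; rewrite -(enum_valK i) basis_sum; case: ifP => // /z.
by rewrite enum_valK.
Qed.

Lemma sum_crd_continuous : continuous (fun y : 'rV[R]_#|V| => \sum_v crd y v).
Proof.
have -> : (fun y : 'rV[R]_#|V| => \sum_v crd y v) =
          \sum_v (fun y : 'rV[R]_#|V| => crd y v : R).
  by apply/funext=> y; rewrite fct_sumE.
apply: (big_ind (fun F : 'rV[R]_#|V| -> R => continuous F)).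
- by move=> y; exact: cst_continuous.
- by move=> F H cF cH y; apply: continuousD; [exact: cF | exact: cH].
- by move=> v _; exact: coord_continuous.
Qed.

(** A finite union of coordinate boxes, one for each simplex, cut by the closed hyperplane of total
    weight 1. *)
Lemma realization_compact : compact (@realization R V K).
Proof.
(* Coordinates outside [sg] are confined to the one-point segment at 0. *)
pose C (sg : {set V}) (i : 'I_#|V|) : set R :=
  if enum_val i \in sg then `[0, 1]%classic else `[0, 0]%classic.
pose D (sg : {set V}) := [set y : 'rV[R]_#|V| | forall i, C sg i (y ord0 i)].
have cD sg : compact (D sg).
  by apply: rV_compact => i; rewrite /C; case: ifP => _; exact: segment_compact.
have cS : closed [set y : 'rV[R]_#|V| | \sum_v crd y v = 1].
  apply: (@preimage_closed _ _ (fun y : 'rV[R]_#|V| => \sum_v crd y v) [set 1%R]).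
    by move=> y _; exact: sum_crd_continuous.
  exact: closed_eq.
have -> : @realization R V K =
   (\big[setU/set0]_(sg in K) D sg) `&` [set y : 'rV[R]_#|V| | \sum_v crd y v = 1].
  apply/seteqP; split=> y.
    move=> /realizationP[y0 y1 yK]; split=> //=.
    rewrite (bigD1 [set v | 0 < crd y v]%SET) //=; left=> i; rewrite /C inE enum_valK.
    have yi := y0 (enum_val i); rewrite enum_valK in yi.
    case: ifP => h; rewrite /= in_itv /= yi /=.
      rewrite -y1 (bigD1 (enum_val i)) //= enum_valK lerDl; exact: sumr_ge0.
    by rewrite leNgt h.
  move=> [+ y1]; rewrite -bigcup_seq_cond => -[sg /andP[_ sgK] Dy].
  have yv v : 0 <= crd y v /\ (v \notin sg -> crd y v = 0).
    have := Dy (enum_rank v); rewrite /C enum_rankK; case: ifP => _ /=.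
      by rewrite in_itv /= => /andP[].
    by rewrite in_itv /= -eq_le => /eqP <-.
  apply/realizationP; split=> //; first by move=> v; have [] := yv v.
  apply: cK.2 sgK _; apply/fintype.subsetP=> v; rewrite inE.
  by apply: contraTT => /(yv v).2 ->; rewrite ltxx.
apply: compact_closedI => //; exact: bigsetU_compact.
Qed.

(** The Heine-Cantor theorem for [phi \o g] on the compact realization, read back on [X]. *)
Lemma realization_uniform (X : topologicalType) (f : X -> 'rV[R]_#|V|) (g : 'rV[R]_#|V| -> X)
    (phi : X -> R) :
  {within (@realization R V K), continuous g} -> continuous phi ->
  (forall x, realization R K (f x)) -> (forall x, g (f x) = x) ->
  forall e, 0 < e -> exists2 de, 0 < de & forall x y,
    (forall v, `|crd (f x) v - crd (f y) v| < de) -> `|phi x - phi y| < e.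
Proof.
move=> cg cphi fA gf e e0; pose A := @realization R V K.
pose psi y := phi (g y).
have cpsi y : A y -> psi z @[z --> within A (nbhs y)] --> psi y.
  move=> Ay; apply: (@cvg_comp _ _ _ g phi); last exact: cphi.
  by move/subspace_continuousP: cg; exact.
pose P (d : R) y := A y -> forall z, A z -> (forall i, `|y ord0 i - z ord0 i| < d) ->
  `|psi y - psi z| < e.
have H : \forall d \near (0 : R)^'+, A `<=` P d.
  apply: (compact_near_coveringP A).1; first exact: realization_compact.
  move=> y Ay.
  have e2 : 0 < e / 2 by rewrite divr_gt0.
  have /cvgrPdist_lt/(_ _ e2) := cpsi y Ay.
  move=> /nbhs_ballP[r r0 hr].
  have r2 : 0 < r / 2 by rewrite divr_gt0.
  (* Half of the radius for the center and half for [d], so that both points lie within [r] of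
     [y]. *)
  exists (ball y (r / 2), [set d : R | d < r / 2]).
    by split=> /=; [exact: nbhsx_ballx | exact: nbhs_right_lt].
  move=> [z d] /= [yz dr] Az w Aw zw.
  have yr u : A u -> (forall i, `|y ord0 i - u ord0 i| < r) -> `|psi y - psi u| < e / 2.
    by move=> Au h; apply: hr Au; split=> // i' j'; rewrite (ord1 i'); exact: h.
  have yz' i : `|y ord0 i - z ord0 i| < r / 2 by exact: yz.2.
  have h1 : `|psi y - psi z| < e / 2.
    by apply: yr => // i; apply: lt_trans (yz' i) _; lra.
  have h2 : `|psi y - psi w| < e / 2.
    apply: yr => // i; apply: le_lt_trans (ler_distD (z ord0 i) _ _) _.
    by have := yz' i; have := zw i; lra.
  apply: le_lt_trans (ler_distD (psi y) _ _) _; rewrite distrC.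
  by move: h1 h2; lra.
have [d [d0 Pd]] : exists d : R, 0 < d /\ A `<=` P d.
  have H0 : \forall d \near (0 : R)^'+, 0 < d by exact: nbhs_right_gt.
  by have [d [? ?]] := filter_ex (filterI H0 H); exists d.
exists d => // x y xy.
have := Pd (f x) (fA x) (fA x) (f y) (fA y); rewrite /psi !gf; apply=> i.
by rewrite -(enum_valK i); exact: xy.
Qed.

End Realization.

Section Triangulations.
Import Order.TTheory GRing.Theory Num.Theory.
Import numFieldTopology.Exports numFieldNormedType.Exports.
Local Open Scope ring_scope.
Local Open Scope classical_set_scope.

Local Notation crd y v := (y ord0 (enum_rank v)).

Section BaseCoords.
Variables (R : realType) (X : Type) (V : finType) (K : {set {set V}}).
Variable f : X -> 'rV[R]_#|V|.
Hypotheses (cK : is_complex K) (fA : range f = @realization R V K).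

Lemma range_bary x : bary K (f x).
Proof. by apply/(realizationP cK); rewrite -fA; exists x. Qed.

Lemma bary_onto (l : V -> R) : (forall v, 0 <= l v) -> \sum_v l v = 1 ->
  [set v | 0 < l v]%SET \in K -> exists x, forall v, crd (f x) v = l v.
Proof.
move=> l0 l1 lK; pose y : 'rV[R]_#|V| := \row_i l (enum_val i).
have yE v : crd y v = l v by rewrite mxE enum_rankK.
have : @realization R V K y.
  apply/(realizationP cK); split.
  - by move=> v; rewrite yE.
  - by under eq_bigr => v _ do rewrite yE.
  - by rewrite (_ : [set v | _]%SET = [set v | 0 < l v]%SET) //; apply/setP=> v; rewrite !inE yE.
by rewrite -fA => -[x _ xy]; exists x => v; rewrite xy.
Qed.

Definition base_coords : coords R X :=
  @Coords R X V K (fun x v => crd (f x) v) cK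
   (fun x v => let: And3 h _ _ := range_bary x in h v)
   (fun x => let: And3 _ h _ := range_bary x in h)
   (fun x => let: And3 _ _ h := range_bary x in h) bary_onto.

End BaseCoords.

Lemma base_controls (R : realType) (X : topologicalType) (V W : finType)
    (K : {set {set V}}) (L : {set {set W}}) (f : X -> 'rV[R]_#|V|) (g : 'rV[R]_#|V| -> X)
    (f' : X -> 'rV[R]_#|W|) (cK : is_complex K) (cL : is_complex L)
    (fA : range f = @realization R V K) (fA' : range f' = @realization R W L) :
  {within (@realization R V K), continuous g} -> (forall x, g (f x) = x) ->
  continuous f' -> controls (base_coords cK fA) (base_coords cL fA').
Proof.
move=> cg gf cf' e e0.
have fR x : realization R K (f x) by rewrite -fA; exists x.
have /choice[d dP] : forall w : W, exists d : R, 0 < d /\ forall x y,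
    (forall v, `|crd (f x) v - crd (f y) v| < d) -> `|crd (f' x) w - crd (f' y) w| < e.
  move=> w; have cw : continuous (fun x => crd (f' x) w : R).
    move=> x; apply: (@cvg_comp _ _ _ f' (fun y : 'rV[R]_#|W| => crd y w)); first exact: cf'.
    exact: coord_continuous.
  by have [d d0 h] := realization_uniform cK cg cw fR gf e0; exists d.
(* The finitely many moduli are replaced by their minimum, cut off at 1. *)
exists (\big[Num.min/1]_w d w).
  by apply: lt_bigmin => // w _; have [] := dP w.
move=> x y h w; apply: (dP w).2 => v; apply: lt_le_trans (h v) _; exact: bigmin_le.
Qed.

Lemma homeomorphic_LH (R : realType) (X Y : topologicalType) (V1 V2 : finType)
    (K1 : {set {set V1}}) (K2 : {set {set V2}}) (G : zmodType) red i j :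
  triangulation R X K1 -> triangulation R Y K2 -> homeomorphic X Y ->
  zmod_iso (LH G K1 red i j) (LH G K2 red i j).
Proof.
move=> [cK1 [f1 [g1 [cf1 cg1 fA1 gf1]]]] [cK2 [f2 [g2 [cf2 cg2 fA2 gf2]]]].
move=> [h [k [ch ck hk kh]]].
(* The inverse map [g1] is defined on the whole vector space, so [X] has a point. *)
have x0 : inhabited X by split; exact: g1 0.
(* The triangulation of [Y] is transported to [X], so that both coordinate systems live on one
   space. *)
have cf2h : continuous (f2 \o h).
  by move=> x; apply: (@cvg_comp _ _ _ h f2); [exact: ch | exact: cf2].
have fA2h : range (f2 \o h) = @realization R V2 K2.
  rewrite -fA2; apply/seteqP; split=> [_ [x _ <-]|_ [y _ <-]]; first by exists (h x).
  by exists (k y) => //=; rewrite kh.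
have cg2k : {within (@realization R V2 K2), continuous (k \o g2)}.
  move=> y; apply: (@cvg_comp _ _ _ g2 k); [exact: cg2 | exact: ck].
apply: (@coords_LH R X G (base_coords cK1 fA1) (base_coords cK2 fA2h)) => //.
  exact: base_controls cg1 gf1 cf2h.
apply: base_controls cg2k _ cf1; by move=> x /=; rewrite gf2 hk.
Qed.

End Triangulations.

Theorem theorem10 :
  (forall (V : finType) (G : zmodType) (K : {set {set V}}) (sg : {set V}),
      is_complex K -> sg \in K ->
      forall s t : int,
        zmod_iso (LH G K false s t) (LH G (stellar K sg) false s t) /\
        zmod_iso (LH G K true s t) (LH G (stellar K sg) true s t))
  /\
  (forall (R : realType) (X Y : topologicalType)
          (V1 V2 : finType) (K1 : {set {set V1}}) (K2 : {set {set V2}})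
          (G : zmodType),
      triangulation R X K1 -> triangulation R Y K2 -> homeomorphic X Y ->
      forall s t : int,
        zmod_iso (LH G K1 false s t) (LH G K2 false s t) /\
        zmod_iso (LH G K1 true s t) (LH G K2 true s t)).
Proof.
split.
  move=> V G K sg cK sgK s t.
  have [car S] := stellar_subdivision sg cK.
  by split; exact: subdivision_LH S.
move=> R X Y V1 V2 K1 K2 G T1 T2 h s t.
by split; exact: homeomorphic_LH T1 T2 h.
Qed.
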